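(* Let $S^1$ be the unit circle and let $(A,S^1)$ be a regular uniform algebra. If $A$ has dense invertible group then $A=C(S^1)$.
   Context: A uniform algebra $(A,X)$ is a supremum-norm-closed subalgebra of $C(X)$ ($X$ compact Hausdorff) separating the points of $X$ and containing the constants. Let $\Omega$ be its character space with the weak-* topology. $A$ is regular if for each closed set $E\subseteq\Omega$ and each $\omega\in\Omega-E$ there exists $a\in A$ with $\hat a(E)\subseteq\{0\}$ and $\hat a(\omega)=1$, where $\hat a(\omega)=\omega(a)$. $A$ has dense invertible group if its group of invertible elements is dense in $A$. *)

(* Defs.v *)
From HB Require Import structures.
From mathcomp Require Import all_boot all_order all_algebra complex.
From mathcomp Require Import all_classical all_reals all_analysis.

Set Implicit Arguments.
Unset Strict Implicit.
Unset Printing Implicit Defensive.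

Import Order.TTheory GRing.Theory Num.Theory.
Import numFieldNormedType.Exports.

Local Open Scope classical_set_scope.
Local Open Scope complex_scope.
Local Open Scope ring_scope.

(* The usual topology of the complex numbers, given by the modulus; [R[i]] has
   no canonical topology in the libraries. *)
HB.instance Definition _ (R : realType) := NormedModule.copy R[i] R[i]^o.

Section UniformAlgebra.
Context {R : realType} {X : topologicalType}.
Implicit Types A : set (X -> R[i]).

Definition C_of : set (X -> R[i]) := [set f | continuous f].

(* For compact X, the topology of [{uniform X -> R[i]}] restricts on [C_of] to
   that of the supremum norm, and [C_of] is closed for it; hence a subset of
   [C_of] is closed in [{uniform X -> R[i]}] iff it is closed in C(X). *)
Record uniform_algebra A : Prop := UniformAlgebra {
  ualg_compact : compact [set: X];
  ualg_hausdorff : hausdorff_space X;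
  ualg_continuous : A `<=` C_of;
  ualg_cst : forall c : R[i], A (cst c);
  ualg_add : forall f g, A f -> A g -> A (f + g);
  ualg_scale : forall (c : R[i]) f, A f -> A (c *: f);
  ualg_mul : forall f g, A f -> A g -> A (f * g);
  ualg_closed : closed (A : set {uniform X -> R[i]});
  ualg_separates : forall x y : X, x <> y -> exists2 f, A f & f x <> f y
}.

(* Addition, scaling and multiplication of the subtype [A] are those of
   [X -> R[i]], whence the relational form of the morphism conditions. No
   continuity is required: it is automatic for characters of a uniform
   algebra. The type [{ptws A -> R[i]}] only serves to give the set of
   characters its weak-* topology. *)
Record is_character A (w : {ptws A -> R[i]}) : Prop := IsCharacter {
  character_add : forall a b c : A,
    set_val c = set_val a + set_val b -> w c = w a + w b;
  character_scale : forall (k : R[i]) (a b : A),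
    set_val b = k *: set_val a -> w b = k * w a;
  character_mul : forall a b c : A,
    set_val c = set_val a * set_val b -> w c = w a * w b;
  character_neq0 : exists a : A, w a <> 0
}.

Definition character_set A : set {ptws A -> R[i]} := [set w | is_character w].

(* As a subtype of [{ptws A -> R[i]}] it carries the topology of pointwise
   convergence on [A]. *)
Definition character_space A : topologicalType := set_type (@character_set A).

Definition gelfand A (a : A) : character_space A -> R[i] :=
  fun w => set_val w a.

Definition regular_algebra A : Prop :=
  forall E : set (character_space A), closed E ->
  forall w : character_space A, ~ E w ->
  exists a : A, gelfand a @` E `<=` [set 0] /\ gelfand a w = 1.

Definition invertible_group A : set (X -> R[i]) :=
  [set f | A f /\ exists2 g, A g & f * g = 1].

(* Density is for the supremum norm. *)
Definition dense_invertible_group A : Prop :=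
  A `<=` closure (invertible_group A : set {uniform X -> R[i]}).

End UniformAlgebra.

Arguments C_of R X : clear implicits.
Arguments character_set {R X} A _.

Definition unit_circle (R : realType) : set R[i] := [set z | `|z| = 1].

Arguments unit_circle R : clear implicits.

(* Main.v *)
Require Import Defs.
From HB Require Import structures.
From mathcomp Require Import all_boot all_order all_algebra complex.
From mathcomp Require Import all_classical all_reals all_analysis.
From mathcomp Require Import ring lra.

Set Implicit Arguments.
Unset Strict Implicit.
Unset Printing Implicit Defensive.

Import Order.TTheory GRing.Theory Num.Theory Normc.
Import numFieldNormedType.Exports.

Local Open Scope classical_set_scope.
Local Open Scope complex_scope.
Local Open Scope ring_scope.

(** In one dimension a nowhere zero function has continuous roots along any
arc that is not the whole circle. This is what makes the density of invertible
elements strong: an element of [A] that vanishes on one piece of an arc and is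
[1] on another piece is close to an invertible one, and a high power-of-two
root of the latter is still small on the first piece, close to [1] on the
second, and bounded by [2] in between. Such approximate step functions
([approx_on_arc_step]) have a bound that does not depend on how close the two
pieces are, so staircases built from them approximate every continuous
function on the arc ([approx_on_arc]). Two arcs cover the circle.

Two things are needed to carry this out inside [A].

Cutting and gluing. Regularity is a statement about the character space, and
it forces every character to be a point evaluation: the points form a closed
set of characters, and an element of [A] that is zero on that set is zero, so
it cannot take the value [1] at another character. Hence an ideal of [A]
without common zero is all of [A] ([maximal_ideal_point]), which yields
elements of [A] equal to [0] on one closed set and to [1] on a disjoint one
([regular_normal]). With such cutoffs, a function that is a uniform limit of
elements of [A] on two overlapping pieces is one on their union
([approx_on_glue]).

Characters. To turn a maximal ideal into a character one needs the
Gelfand-Mazur theorem. It is proved without holomorphic functions, following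
Rickart: averaging the resolvent of [a] over the [2 ^ j]-th roots of unity
turns [a / (a - z)] into [a ^ n / (a ^ n - z ^ n)] for [n = 2 ^ j], and keeps
a Lipschitz constant in [z] that is independent of [j]. For large [n] these
functions are close to [1] for small [z] and close to [0] for large [z], and a
uniform Lipschitz bound forbids the jump.

Roots along an arc ([approx_on_arc_sqrt]) are found by advancing along the arc
by small steps: on a short arc the function is close to a constant, its square
root is a uniform limit of polynomials in it, and the sign is chosen so that
the new piece continues the old one. *)

(** * The modulus, and elementary properties of uniform algebras *)

Section Modulus.
Context {R : realType}.
Implicit Types (z w : R[i]) (r : R).

Lemma normr_normc z : `|z| = (normc z)%:C.
Proof. by case: z. Qed.

Lemma normc_ge0 z : 0 <= normc z.
Proof. by case: z => a b; rewrite sqrtr_ge0. Qed.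

Lemma normcD z w : normc (z + w) <= normc z + normc w.
Proof. exact: le_normcD. Qed.

Lemma normcNE z : normc (- z) = normc z.
Proof. exact: normcN. Qed.

Lemma normcB z w : normc (z - w) <= normc z + normc w.
Proof. by rewrite -(normcNE w); exact: normcD. Qed.

Lemma normc_distC z w : normc (z - w) = normc (w - z).
Proof. by rewrite -normcNE opprB. Qed.

Lemma normcX z n : normc (z ^+ n) = normc z ^+ n.
Proof.
by elim: n => [|n IH]; rewrite ?expr0 ?normc1// !exprS normcM IH.
Qed.

Lemma normc_real r : normc r%:C = `|r|.
Proof. by rewrite /= expr0n addr0 sqrtr_sqr. Qed.

Lemma normc_Re z : `|complex.Re z| <= normc z.
Proof. by rewrite -lecR -normr_normc; exact: normc_ge_Re. Qed.

Lemma normc_eq0 z : (normc z == 0) = (z == 0).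
Proof.
by apply/eqP/eqP => [/eq0_normc//|->]; rewrite normc0.
Qed.

Lemma normc_gt0 z : (0 < normc z) = (z != 0).
Proof. by rewrite lt_def normc_eq0 normc_ge0 andbT. Qed.

Lemma sqr_eq_sign z w : z ^+ 2 = w ^+ 2 -> z = w \/ z = - w.
Proof.
by move/eqP; rewrite eqf_sqr => /orP[]/eqP; [left|right].
Qed.

Lemma cvgcP {T : Type} {F : set_system T} {FF : Filter F} (f : T -> R[i]) z :
  f @ F --> z <-> forall e, 0 < e -> \forall t \near F, normc (z - f t) < e.
Proof.
split=> [/cvgrPdist_lt fz e e0|fz].
  have := fz e%:C; rewrite ltcR => /(_ e0).
  by apply: filterS => t; rewrite normr_normc ltcR.
apply/cvgrPdist_lt => e e0.
have /complex_realP[r er] := gtr0_real e0.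
move: e0; rewrite er ltcR => /fz; apply: filterS => t.
by rewrite normr_normc ltcR.
Qed.

End Modulus.

Section UniformAlgebras.
Context {R : realType} {X : topologicalType}.
Variable A : set (X -> R[i]).
Hypothesis ua : uniform_algebra A.

Lemma ualg_lim (f : X -> R[i]) :
  (forall e : R, 0 < e -> exists2 g, A g & forall x, normc (f x - g x) <= e) ->
  A f.
Proof.
move=> H; apply: (ualg_closed ua) => B /uniform_nbhs[E [entE EB]].
have [e /= e0 eE] : exists2 e : R, 0 < e &
    forall z w : R[i], normc (z - w) < e -> E (z, w).
  move: entE; rewrite -entourage_ballE => -[e /= e0 eE].
  have /complex_realP[r er] := gtr0_real e0.
  exists r; first by move: e0; rewrite er ltcR.
  by move=> z w zw; apply: eE => /=; rewrite -ball_normE /= er normr_normc ltcR.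
have e20 : 0 < e / 2 by lra.
have [g Ag fg] := H _ e20.
exists g; split => //; apply: EB => y _ /=; apply: eE.
by have := fg y; lra.
Qed.

Lemma ualg_bounded f : A f -> exists2 M : R, 0 < M & forall x, normc (f x) <= M.
Proof.
move=> Af; have cf := ualg_continuous ua Af.
have cX := iffLR (compact_near_coveringP _) (ualg_compact ua).
have [] := cX R +oo%R (fun M x => normc (f x) <= M) _ _.
  move=> x _.
  have /cvgcP/(_ _ ltr01) H := cf x.
  exists ([set y | normc (f x - f y) < 1], [set M | normc (f x) + 1 <= M]).
    split; first by [].
    rewrite -[X in X _]/(nbhs +oo%R); apply: nbhs_pinfty_ge.
    exact: num_real.
  move=> [y M] /= [fxy fM].
  have := normcB (f x) (f x - f y); rewrite opprB addrC subrK; lra.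
move=> M0 [_ H]; exists (Num.max M0 0 + 1).
  by rewrite ltr_wpDl// le_max lexx orbT.
move=> x; apply: H => //.
by rewrite (@le_lt_trans _ _ (Num.max M0 0)) ?le_max ?lexx// ltrDl.
Qed.

Lemma ualg_opp f : A f -> A (- f).
Proof. by move=> Af; rewrite -scaleN1r; exact: ualg_scale. Qed.

Lemma ualg_sub f g : A f -> A g -> A (f - g).
Proof. by move=> Af Ag; apply: ualg_add => //; exact: ualg_opp. Qed.

Lemma ualg_exp f n : A f -> A (fun x => f x ^+ n).
Proof.
move=> Af; elim: n => [|n IH]; first exact: (ualg_cst ua 1).
by under eq_fun do rewrite exprS; exact: (ualg_mul ua Af IH).
Qed.

(** The Neumann series, with the remainder [(1 - f) ^ n / f] estimated
pointwise: no convergence of series is needed, since [f^-1] exists as a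
function and [A] is closed under uniform limits. *)
Lemma ualg_neumann f (r : R) :
  A f -> r < 1 -> (forall x, normc (1 - f x) <= r) -> A (fun x => (f x)^-1).
Proof.
move=> Af r1 fr.
pose S n := fun x => \sum_(k < n) (1 - f x) ^+ k.
have AS n : A (S n).
  elim: n => [|n IH].
    by rewrite /S; under eq_fun do rewrite big_ord0; exact: (ualg_cst ua 0).
  rewrite /S; under eq_fun do rewrite big_ord_recr.
  apply: (ualg_add ua IH); apply: ualg_exp; apply: ualg_sub => //.
  exact: (ualg_cst ua 1).
have fn0 x : 1 - r <= normc (f x).
  have := normcD (f x) (1 - f x); rewrite addrC subrK normc1; have := fr x; lra.
have f0 x : f x != 0 by rewrite -normc_gt0; have := fn0 x; lra.
have SE n x : (f x)^-1 - S n x = (1 - f x) ^+ n / f x.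
  have /eqP := subrX1 (1 - f x) n.
  rewrite (_ : 1 - f x - 1 = - f x); last by ring.
  move=> /eqP H; apply: (mulfI (f0 x)).
  rewrite mulrBr mulfV// mulrCA mulfV// mulr1.
  by rewrite -[f x * _]opprK -mulNr -H; ring.
apply: ualg_lim => e e0.
have [x0|nX] := pselect (exists x : X, True); last first.
  by exists (S 0%N) => // x; exfalso; apply: nX; exists x.
have r0 : 0 <= r by case: x0 => x _; exact: le_trans (normc_ge0 _) (fr x).
have : (fun n => r ^+ n) @ \oo --> (0 : R) by apply: cvg_expr; rewrite ger0_norm.
have er0 : 0 < e * (1 - r) by rewrite mulr_gt0// subr_gt0.
move=> /cvgrPdist_lt/(_ _ er0) [n _ /(_ n (leqnn n))] /=.
rewrite sub0r normrN ger0_norm ?exprn_ge0// => rn.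
exists (S n) => // x; rewrite SE normcM normcX normcV.
rewrite ler_pdivrMr ?normc_gt0//.
apply: (le_trans (lerXn2r n _ _ (fr x))); rewrite ?nnegrE ?normc_ge0//.
by apply: (le_trans (ltW rn)); rewrite ler_pM2l.
Qed.

Lemma dense_nowhere_zero f (e : R) : dense_invertible_group A ->
  A f -> 0 < e ->
  exists2 g, A g & (forall x, g x != 0) /\ (forall x, normc (f x - g x) < e).
Proof.
move=> dA Af e0; have := dA _ Af.
move=> /(_ [set g | forall x, normc (f x - g x) < e]) [].
  apply/uniform_nbhs; exists [set zw | normc (zw.1 - zw.2) < e]; split.
    rewrite -entourage_ballE; exists e%:C; first by rewrite /= ltcR.
    by move=> [z w] /=; rewrite -ball_normE /= normr_normc ltcR.
  by move=> h fh x /=; exact: fh.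
move=> g [[Ag [h _ gh]] fg]; exists g => //; split=> // x.
apply/negP => /eqP gx; have := congr1 (fun u => u x) gh.
by rewrite /= fctE gx mul0r => /esym/eqP; rewrite oner_eq0.
Qed.

Lemma ualgD f g : A f -> A g -> A (fun x => f x + g x).
Proof. exact: ualg_add. Qed.

Lemma ualgM f g : A f -> A g -> A (fun x => f x * g x).
Proof. exact: ualg_mul. Qed.

Lemma ualgC (c : R[i]) : A (fun=> c).
Proof. exact: (ualg_cst ua c). Qed.

Lemma ualgB f g : A f -> A g -> A (fun x => f x - g x).
Proof. exact: ualg_sub. Qed.

Lemma ualgZ (c : R[i]) f : A f -> A (fun x => c * f x).
Proof. by move=> Af; apply: ualgM => //; exact: ualgC. Qed.

End UniformAlgebras.

(** * Maximal ideals *)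

Section Ideals.
Context {R : realType} {X : topologicalType}.
Variable A : set (X -> R[i]).
Hypothesis ua : uniform_algebra A.

Record ideal (M : set (X -> R[i])) : Prop := Ideal {
  ideal_sub : M `<=` A;
  ideal_zero : M (fun=> 0);
  ideal_add : forall f g, M f -> M g -> M (fun x => f x + g x);
  ideal_mul : forall f g, A f -> M g -> M (fun x => f x * g x)
}.

Record maximal_ideal (M : set (X -> R[i])) : Prop := MaximalIdeal {
  maximal_idealP :> ideal M;
  maximal_proper : ~ M (fun=> 1);
  maximal_inv : forall f, A f -> ~ M f ->
    exists2 g, A g & M (fun x => g x * f x - 1)
}.

(** Zorn's lemma is applied to the sets whose union with [I] is a proper ideal,
so that the empty chain needs no separate treatment. *)
Lemma maximal_ideal_above I : ideal I -> ~ I (fun=> 1) ->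
  exists2 M, maximal_ideal M & I `<=` M.
Proof.
move=> idI I1.
pose P J := ideal (I `|` J) /\ ~ (I `|` J) (fun=> 1).
have [|J [[idJ J1] Jmax]] := @Zorn_bigcup _ P.
  move=> F FP Ftot; split; last first.
    by case=> // -[J FJ J1]; have [_] := FP _ FJ; apply; right.
  split.
  - move=> f [|[J FJ Jf]]; first exact: (ideal_sub idI).
    by apply: (ideal_sub (FP _ FJ).1); right.
  - by left; exact: ideal_zero.
  - have up f g J : F J -> I f \/ J f -> I g \/ J g ->
        (I `|` \bigcup_(X in F) X) (fun x => f x + g x).
      move=> FJ fJ gJ.
      by case: (ideal_add (FP _ FJ).1 fJ gJ) => ?; [left|right; exists J].
    move=> f g [If|[J FJ Jf]] [Ig|[K FK Kg]].
    + by left; exact: ideal_add.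
    + by apply: (up f g K) => //; [left|right].
    + by apply: (up f g J) => //; [right|left].
    + have [JK|KJ] := Ftot _ _ FJ FK.
        by apply: (up f g K) => //; right => //; exact: JK.
      by apply: (up f g J) => //; right => //; exact: KJ.
  - move=> f g Af [Ig|[J FJ Jg]]; first by left; exact: ideal_mul.
    have [|?|?] := ideal_mul (FP _ FJ).1 Af (g := g); first by right.
      by left.
    by right; exists J.
exists (I `|` J); last by move=> f If; left.
split=> // f Af Jf.
pose K := [set h | exists2 g, A g & (I `|` J) (fun x => h x - g x * f x)].
have AD g h : A g -> A h -> A (fun x => g x + h x) by exact: ualg_add.
have AM g h : A g -> A h -> A (fun x => g x * h x) by exact: ualg_mul.
have JK : I `|` J `<=` K.
  move=> h Jh; exists (fun=> 0); first exact: (ualg_cst ua 0).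
  by under eq_fun do rewrite mul0r subr0.
have Kf : K f.
  exists (fun=> 1); first exact: (ualg_cst ua 1).
  by under eq_fun do rewrite mul1r subrr; exact: ideal_zero.
have idK : ideal K.
  split.
  - move=> h [g Ag /(ideal_sub idJ) Ah].
    suff -> : h = (fun x => (h x - g x * f x) + g x * f x).
      by apply: AD => //; exact: AM.
    by apply/funext => x; ring.
  - by apply: JK; exact: ideal_zero.
  - move=> h1 h2 [g1 Ag1 J1'] [g2 Ag2 J2'].
    exists (fun x => g1 x + g2 x); first exact: AD.
    rewrite (_ : (fun x => _) = (fun x => (h1 x - g1 x * f x) +
      (h2 x - g2 x * f x))); first exact: ideal_add.
    by apply/funext => x; ring.
  - move=> h1 h2 Ah [g2 Ag2 J2'].
    exists (fun x => h1 x * g2 x); first exact: AM.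
    rewrite (_ : (fun x => _) = (fun x => h1 x * (h2 x - g2 x * f x))).
      exact: ideal_mul.
    by apply/funext => x; ring.
have IK : I `|` K = K by apply/setUidPr => g Ig; apply: JK; left.
have [K1|K1] := pselect (K (fun=> 1)); last first.
  exfalso; apply: (Jmax K); last by rewrite /P IK.
  split; last by move=> KJ; apply: Jf; right; exact: KJ.
  by move=> g Jg; apply: JK; right.
case: K1 => g Ag Jg; exists g => //.
rewrite (_ : (fun x => _) = (fun x => (- 1) * (1 - g x * f x))).
  by apply: (ideal_mul idJ) => //; exact: (ualg_cst ua (-1)).
by apply/funext => x; ring.
Qed.

End Ideals.

(** * The quotient seminorm of a maximal ideal *)

Section QuotientSeminorm.
Context {R : realType} {X : topologicalType}.
Variable A : set (X -> R[i]).
Hypothesis ua : uniform_algebra A.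
Variable M : set (X -> R[i]).
Hypothesis maxM : maximal_ideal A M.
Implicit Types f g h : X -> R[i].

Lemma idealZ (c : R[i]) f : M f -> M (fun x => c * f x).
Proof. by move=> Mf; apply: (ideal_mul maxM) => //; exact: ualgC. Qed.

Lemma idealB f g : M f -> M g -> M (fun x => f x - g x).
Proof.
move=> Mf Mg; rewrite (_ : (fun x => _) = (fun x => f x + (-1) * g x)).
  by apply: ideal_add => //; [exact: maxM|exact: idealZ].
by apply/funext => x; ring.
Qed.

(** An upper bound, attained by a representative, for the quotient seminorm of
[f] modulo [M]. Working with bounds avoids both the quotient algebra and the
infimum that defines its norm. *)
Definition qle f (r : R) := exists2 m, M m & forall x, normc (f x - m x) <= r.

Lemma qleD f g r s : qle f r -> qle g s -> qle (fun x => f x + g x) (r + s).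
Proof.
move=> [m Mm fm] [n Mn gn]; exists (fun x => m x + n x).
  by apply: ideal_add => //; exact: maxM.
move=> x; rewrite opprD addrACA; apply: le_trans (normcD _ _) _.
by rewrite lerD.
Qed.

Lemma qleM f g r s : A f -> A g -> qle f r -> qle g s ->
  qle (fun x => f x * g x) (r * s).
Proof.
move=> Af Ag [m Mm fm] [n Mn gn].
exists (fun x => f x * n x + (g x - n x) * m x).
  apply: ideal_add; [exact: maxM|exact: ideal_mul maxM _ _ Af Mn|].
  apply: ideal_mul maxM _ _ _ Mm; apply: ualgB => //.
  exact: (ideal_sub maxM).
move=> x.
rewrite (_ : _ - _ = (f x - m x) * (g x - n x)); last by ring.
by rewrite normcM ler_pM ?normc_ge0.
Qed.

Lemma qleZ (c : R[i]) f r : qle f r -> qle (fun x => c * f x) (normc c * r).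
Proof.
move=> [m Mm fm]; exists (fun x => c * m x); first exact: idealZ.
by move=> x; rewrite -mulrBr normcM ler_wpM2l ?normc_ge0.
Qed.

Lemma qleW f r s : r <= s -> qle f r -> qle f s.
Proof. by move=> rs [m Mm fm]; exists m => // x; exact: le_trans (fm x) rs. Qed.

Lemma qle_eqmod f g r : M (fun x => g x - f x) -> qle f r -> qle g r.
Proof.
move=> Mgf [m Mm fm]; exists (fun x => m x + (g x - f x)).
  by apply: ideal_add => //; exact: maxM.
by move=> x; rewrite (_ : _ - _ = f x - m x)//; ring.
Qed.

Lemma qle_sup f r : (forall x, normc (f x) <= r) -> qle f r.
Proof.
move=> fr; exists (fun=> 0); first by apply: ideal_zero; exact: maxM.
by move=> x; rewrite subr0.
Qed.

Lemma qleX f r n : A f -> qle f r -> qle (fun x => f x ^+ n) (r ^+ n).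
Proof.
move=> Af fr; elim: n => [|n IH].
  by apply: qle_sup => x; rewrite !expr0 normc1.
rewrite exprS; under eq_fun do rewrite exprS.
by apply: qleM => //; exact: ualg_exp.
Qed.

(** Neumann's lemma in the quotient: the representative [f + m] is within [r] of
[1] in sup norm, so that it is invertible in [A] itself. *)
Lemma qle_inv f r : A f -> r < 1 -> qle (fun x => 1 - f x) r ->
  exists2 g, A g &
    M (fun x => g x * f x - 1) /\ qle (fun x => g x - 1) (r / (1 - r)).
Proof.
move=> Af r1 [m Mm fm].
have Am : A m by exact: (ideal_sub maxM).
pose h x := f x + m x.
have hr x : normc (1 - h x) <= r by rewrite /h opprD addrA.
have Ah : A h by exact: ualgD.
have Ai := ualg_neumann ua Ah r1 hr.
have hn x : 1 - r <= normc (h x).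
  have := normcD (h x) (1 - h x); rewrite addrC subrK normc1.
  have := hr x; lra.
have h0 x : h x != 0 by rewrite -normc_gt0; have := hn x; lra.
exists (fun x => (h x)^-1) => //; split.
  rewrite (_ : (fun x => _) = (fun x => (- (h x)^-1) * m x)).
    apply: ideal_mul Mm; first exact: maxM.
    exact: ualg_opp.
  apply/funext => x; have := h0 x; rewrite /h => hx; field.
  exact: hx.
apply: qle_sup => x.
rewrite (_ : _ - 1 = (1 - h x) / h x); last by field; exact: h0.
have r0 : 0 <= r := le_trans (normc_ge0 _) (hr x).
rewrite normcM normcV; apply: ler_pM; rewrite ?invr_ge0 ?normc_ge0//.
by rewrite lef_pV2 ?posrE ?normc_gt0// subr_gt0.
Qed.

(** The quotient is not trivial: if [1] were within [r < 1] of an element of [M],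
that element would be invertible. *)
Lemma qle1 r : qle (fun=> 1) r -> 1 <= r.
Proof.
move=> q1; rewrite leNgt; apply/negP => r1.
have [||g Ag [Mg _]] := @qle_inv (fun=> 0) r _ r1; first exact: ualgC.
  by under eq_fun do rewrite subr0.
apply: (maximal_proper maxM).
rewrite (_ : (fun=> 1) = (fun x => (-1) * (g x * 0 - 1))).
  exact: idealZ.
by apply/funext => x; ring.
Qed.

Lemma inv_mod_uniq f g h : A f -> A g -> A h ->
  M (fun x => g x * f x - 1) -> M (fun x => h x * f x - 1) ->
  M (fun x => g x - h x).
Proof.
move=> Af Ag Ah Mg Mh.
rewrite (_ : (fun x => _) =
  (fun x => h x * (g x * f x - 1) - g x * (h x * f x - 1))).
  by apply: idealB; apply: (ideal_mul maxM).
by apply/funext => x; ring.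
Qed.

Lemma inv_modX f g n : A f -> A g -> M (fun x => g x * f x - 1) ->
  M (fun x => g x ^+ n * f x ^+ n - 1).
Proof.
move=> Af Ag Mgf; elim: n => [|n IH].
  under eq_fun do rewrite !expr0 mulr1 subrr.
  by apply: ideal_zero; exact: maxM.
rewrite (_ : (fun x => _) = (fun x =>
   (g x * f x) * (g x ^+ n * f x ^+ n - 1) + (g x * f x - 1))).
  apply: ideal_add => //; first exact: maxM.
  by apply: (ideal_mul maxM) => //; exact: ualgM.
by apply/funext => x; rewrite !exprS; ring.
Qed.

End QuotientSeminorm.

(** * The Gelfand-Mazur theorem *)

Lemma root_of_minus_one {R : realType} j :
  exists2 z : R[i], z ^+ (2 ^ j) = -1 & normc z = 1.
Proof.
elim: j => [|j [z zj z1]].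
  by exists (-1); rewrite ?expr1// normcNE normc1.
exists (sqrtc z); first by rewrite expnS exprM sqr_sqrtc.
have := normcX (sqrtc z) 2; rewrite sqr_sqrtc z1 => /esym/eqP.
by rewrite sqrp_eq1 ?normc_ge0// => /eqP.
Qed.

Section GelfandMazur.
Context {R : realType} {X : topologicalType}.
Variable A : set (X -> R[i]).
Hypothesis ua : uniform_algebra A.
Variable M : set (X -> R[i]).
Hypothesis maxM : maximal_ideal A M.

Variable a : X -> R[i].
Hypothesis Aa : A a.

Definition resolvent_le (z : R[i]) (r : R) := exists2 b, A b &
  (forall x, normc (b x) <= r) /\ M (fun x => b x * (a x - z) - 1).

Lemma resolvent_leW z r s : r <= s -> resolvent_le z r -> resolvent_le z s.
Proof.
move=> rs [b Ab [br Mb]]; exists b => //; split=> // x.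
exact: le_trans (br x) rs.
Qed.

(** The inverse of [a - w] is [b / (1 - (w - z) b)], where [b] is that of
[a - z]; the Neumann series costs a factor [2]. *)
Lemma resolvent_le_near z w r : 0 < r -> resolvent_le z r ->
  normc (w - z) <= (2 * r)^-1 -> resolvent_le w (2 * r).
Proof.
move=> r0 [b Ab [br Mb]] wz.
pose y x := 1 - (w - z) * b x.
have Ay : A y by apply: (ualgB ua); [exact: ualgC|exact: ualgZ].
have y1 x : normc (1 - y x) <= 2^-1.
  rewrite /y opprB addrC subrK normcM.
  have := ler_pM (normc_ge0 _) (normc_ge0 _) wz (br x).
  suff -> : (2 * r)^-1 * r = 2^-1 :> R by [].
  by field; rewrite gt_eqF.
have Ayi := ualg_neumann ua Ay (_ : 2^-1 < 1) y1.
have yn x : 2^-1 <= normc (y x).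
  have := normcD (y x) (1 - y x); rewrite addrC subrK normc1.
  have := y1 x; lra.
have y0 x : y x != 0 by rewrite -normc_gt0; have := yn x; lra.
exists (fun x => b x / y x).
  by apply: ualgM => //; apply: Ayi; lra.
split=> [x|].
  rewrite normcM normcV mulrC ler_pM ?invr_ge0 ?normc_ge0//.
  by rewrite -[leRHS]invrK lef_pV2 ?posrE ?normc_gt0// invr_gt0.
rewrite (_ : (fun x => _) = (fun x => (y x)^-1 * (b x * (a x - z) - 1))).
  by apply: (ideal_mul maxM) => //; apply: Ayi; lra.
apply/funext => x; apply: (mulfI (y0 x)); rewrite mulrA mulfV// mul1r.
rewrite mulrBr mulrA [y x * _]mulrC -[b x / y x * y x]mulrA mulVf// /y; ring.
Qed.

Hypothesis noeig : forall z : R[i], ~ M (fun x => a x - z).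

Lemma resolvent_le_ex z : exists2 r : R, 0 < r & resolvent_le z r.
Proof.
have Az : A (fun x => a x - z) by apply: ualgB => //; exact: ualgC.
have [b Ab Mb] := maximal_inv maxM Az (@noeig z).
have [r r0 br] := ualg_bounded ua Ab.
by exists r => //; exists b.
Qed.

(** Far from the origin the resolvent is bounded by the Neumann series; the
remaining square is compact. *)
Lemma resolvent_le_unif : exists2 r : R, 0 < r & forall z, resolvent_le z r.
Proof.
have [N N0 aN] := ualg_bounded ua Aa.
have far z : N + 1 <= normc z -> resolvent_le z 1.
  move=> zN.
  have z0 : z != 0 by rewrite -normc_gt0; lra.
  pose y x := 1 - z^-1 * a x.
  have Ay : A y by apply: (ualgB ua); [exact: ualgC|exact: ualgZ].
  have y1 x : normc (1 - y x) <= N / (N + 1).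
    rewrite /y opprB addrC subrK normcM normcV mulrC.
    apply: ler_pM; rewrite ?invr_ge0 ?normc_ge0//.
    by rewrite lef_pV2 ?posrE ?normc_gt0//; lra.
  have N1 : N / (N + 1) < 1 by rewrite ltr_pdivrMr; lra.
  have Ayi := ualg_neumann ua Ay N1 y1.
  have azn x : 1 <= normc (a x - z).
    have := normcB (a x) (a x - z); rewrite opprB addrC subrK.
    have := aN x; lra.
  have az0 x : a x - z != 0 by rewrite -normc_gt0; have := azn x; lra.
  exists (fun x => (a x - z)^-1).
    rewrite (_ : (fun x => _) = (fun x => - z^-1 * (y x)^-1)).
      exact: ualgZ.
    apply/funext => x; rewrite /y.
    have zax : z - a x != 0 by rewrite -opprB oppr_eq0.
    by field; rewrite z0 zax az0.
  split=> [x|]; first by rewrite normcV invf_le1 ?normc_gt0.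
  under eq_fun do rewrite mulVf// subrr.
  by apply: ideal_zero; exact: maxM.
pose K := N + 1.
have := compact_setX (@segment_compact R (- K) K) (@segment_compact R (- K) K).
move/(iffLR (compact_near_coveringP _)).
move=> /(_ R +oo%R (fun r xy => resolvent_le (xy.1 +i* xy.2) r) _) [].
  move=> [x y] _; have [r r0 rxy] := resolvent_le_ex (x +i* y).
  pose d := (4 * r)^-1.
  have d0 : 0 < d by rewrite invr_gt0; lra.
  exists ([set xy | `|x - xy.1| < d /\ `|y - xy.2| < d], [set s | 2 * r <= s]).
    split=> /=.
      exists ([set u | `|x - u| < d], [set u | `|y - u| < d]) => /=; last first.
        by case=> u v [].
      split; exact: (@nbhsx_ballx R R).
    rewrite -[X in X _]/(nbhs +oo%R); apply: nbhs_pinfty_ge; exact: num_real.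
  move=> [[u v] s] /= [[xu yv] rs].
  apply: (resolvent_leW rs); apply: resolvent_le_near rxy _ => //.
  rewrite (_ : u +i* v - x +i* y = (u - x)%:C + 'i * (v - y)%:C); last first.
    by simpc.
  apply: (le_trans (normcD _ _)); rewrite normcM !normc_real.
  rewrite (_ : normc 'i = 1); last by rewrite /= expr0n expr1n add0r sqrtr1.
  rewrite mul1r distrC (distrC v).
  have -> : (2 * r)^-1 = d + d by rewrite /d; field; rewrite gt_eqF.
  lra.
move=> r1 [_ near1]; pose r := Num.max r1 1 + 1.
have r11 : r1 < r by rewrite (@le_lt_trans _ _ (Num.max r1 1)) ?le_max ?lexx// ltrDl.
have r1' : 1 < r by rewrite (@le_lt_trans _ _ (Num.max r1 1)) ?le_max ?lexx ?orbT// ltrDl.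
exists r; first lra.
move=> z.
have [zK|/far/(resolvent_leW (ltW r1'))//] := ltP (normc z) K.
rewrite (_ : z = complex.Re z +i* complex.Im z); last by case: z zK.
apply: (near1 r r11 (complex.Re z, complex.Im z)).
have Rez := normc_Re z.
have Imz : `|complex.Im z| <= normc z.
  by case: (z) => x y /=; rewrite -sqrtr_sqr ler_wsqrtr// lerDr sqr_ge0.
by split; rewrite /= in_itv /= -ler_norml; lra.
Qed.

(** [h z] represents [a ^ n / (a ^ n - z ^ n)] for [n = 2 ^ j]. If [t ^ n = -1]
then the mean of [h z] and [h (t * z)] is the corresponding function for
[2 * n]; as [t] has modulus [1], taking the mean preserves the Lipschitz
constant, which is therefore the same for all [j]. *)
Lemma resolvent_mean_lipschitz : exists2 K : R, 0 < K &
  forall j, exists h : R[i] -> X -> R[i],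
  [/\ forall z, A (h z),
      forall z, M (fun x => h z x * (a x ^+ (2 ^ j) - z ^+ (2 ^ j))
                            - a x ^+ (2 ^ j)) &
      forall z w, qle M (fun x => h z x - h w x) (K * normc (z - w))].
Proof.
have [r r0 resr] := resolvent_le_unif.
have [N N0 aN] := ualg_bounded ua Aa.
exists (N * r ^+ 2); first by rewrite mulr_gt0// exprn_gt0.
elim=> [|j [h [Ah Mh lip]]].
  pose b z := s2val (cid2 (resr z)).
  have Ab z : A (b z) by exact: (s2valP (cid2 (resr z))).
  have br z x : normc (b z x) <= r by have [+ _] := s2valP' (cid2 (resr z)); exact.
  have Mb z : M (fun x => b z x * (a x - z) - 1).
    by have [_] := s2valP' (cid2 (resr z)).
  exists (fun z x => a x * b z x); split=> [z|z|z w].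
  - exact: ualgM.
  - rewrite expn0 (_ : (fun x => _) = (fun x => a x * (b z x * (a x - z) - 1))).
      exact: (ideal_mul maxM).
    by apply/funext => x; rewrite !expr1; ring.
  - apply: (@qle_eqmod _ _ A _ maxM (fun x => (z - w) * (a x * b z x * b w x))).
      rewrite (_ : (fun x => _) = (fun x => (a x * b w x) * (b z x * (a x - z) - 1)
        - (a x * b z x) * (b w x * (a x - w) - 1))).
        by apply: (idealB ua maxM); apply: (ideal_mul maxM) => //; exact: ualgM.
      by apply/funext => x; ring.
    apply: (qle_sup maxM) => x; rewrite normcM mulrC.
    rewrite ler_wpM2r ?normc_ge0// !normcM -mulrA.
    apply: ler_pM; rewrite ?mulr_ge0 ?normc_ge0//.
    by apply: ler_pM; rewrite ?normc_ge0.
have [t tj t1] := @root_of_minus_one R j.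
exists (fun z x => 2^-1 * (h z x + h (t * z) x)); split=> [z|z|z w].
- by apply: ualgZ => //; exact: ualgD.
- have Aj : A (fun x => a x ^+ (2 ^ j)) by exact: ualg_exp.
  rewrite (_ : (fun x => _) = (fun x =>
    (2^-1 * (a x ^+ (2 ^ j) + z ^+ (2 ^ j))) *
      (h z x * (a x ^+ (2 ^ j) - z ^+ (2 ^ j)) - a x ^+ (2 ^ j)) +
    (2^-1 * (a x ^+ (2 ^ j) - z ^+ (2 ^ j))) *
      (h (t * z) x * (a x ^+ (2 ^ j) - (t * z) ^+ (2 ^ j)) - a x ^+ (2 ^ j)))).
    apply: (ideal_add maxM); apply: (ideal_mul maxM) => //;
      apply: ualgZ => //; [apply: ualgD => //|apply: ualgB => //]; exact: ualgC.
  apply/funext => x; rewrite exprMn tj expnS mulnC !exprM.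
  by set u := a x ^+ _; set v := z ^+ _; field.
- rewrite (_ : (fun x => _) =
     (fun x => 2^-1 * ((h z x - h w x) + (h (t * z) x - h (t * w) x)))).
    apply: (@qleW _ _ _ _ (normc (2^-1 : R[i]) *
      (N * r ^+ 2 * normc (z - w) + N * r ^+ 2 * normc (t * z - t * w)))).
      rewrite -[t * z - _]mulrBr (normcM t) t1 mul1r.
      rewrite (_ : 2^-1 = (2^-1)%:C); last by rewrite fmorphV rmorph_nat.
      rewrite normc_real ger0_norm; last by rewrite invr_ge0.
      by set u := N * _ * _; lra.
    by apply: (qleZ ua maxM); apply: (qleD maxM).
  by apply/funext => x; ring.
Qed.

(** Write [b] for the inverse of [a] modulo [M]. Call [s] good if some power
[(s * b) ^ (2 ^ j)] has quotient seminorm at most [1/2]. By squaring, the later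
powers are much smaller, so that [h s], the inverse of [1 - (s * b) ^ n]
modulo [M], is close to [1]; by the uniform Lipschitz bound, [h (s + d)] is
then close to [1] too, so that [s + d] is good. Thus arbitrarily large [s] are
good, which is absurd: [(s * b) ^ n * (s^-1 * a) ^ n] is [1] modulo [M], and
the second factor is bounded by [1] once [s] exceeds the sup norm of [a]. *)
Lemma gelfand_mazur_absurd : False.
Proof.
have [K K0 lipK] := resolvent_mean_lipschitz.
have [N N0 aN] := ualg_bounded ua Aa.
have Ma0 : ~ M a.
  move=> Ma; apply: (noeig (z := 0)).
  by under eq_fun do rewrite subr0.
have [b Ab Mba] := maximal_inv maxM Aa Ma0.
pose good (s : R) :=
  exists j, qle M (fun x => (s%:C * b x) ^+ (2 ^ j)) 2^-1.
have Asb (s : R) n : A (fun x => (s%:C * b x) ^+ n).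
  by apply: ualg_exp => //; exact: ualgZ.
pose d := (4 * K)^-1.
have d0 : 0 < d by rewrite invr_gt0; lra.
have good0 : good 0.
  exists 0%N; apply: (qle_sup maxM) => x.
  by rewrite expn0 expr1 rmorph0 mul0r normc0 invr_ge0.
(* The step [d] makes the Lipschitz bound equal to [1/4]. *)
have goodS s : good s -> good (s + d).
  move=> [j sj].
  have sj2 : qle M (fun x => (s%:C * b x) ^+ (2 ^ (j.+2))) 16^-1.
    have := qleX ua maxM 4 (Asb s (2 ^ j)%N) sj.
    under eq_fun do rewrite -exprM -(expnD 2 j 2) addn2.
    by apply: qleW; rewrite exprVn -natrX.
  set n := (2 ^ j.+2)%N in sj2 *.
  have [h [Ah Mh lip]] := lipK j.+2.
  have hinv (t : R) : M (fun x => h t%:C x * (1 - (t%:C * b x) ^+ n) - 1).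
    have Mbn := inv_modX ua maxM n Aa Ab Mba.
    rewrite (_ : (fun x => _) = (fun x =>
      b x ^+ n * (h t%:C x * (a x ^+ n - t%:C ^+ n) - a x ^+ n)
      + (1 - h t%:C x) * (b x ^+ n * a x ^+ n - 1))).
      apply: (ideal_add maxM); apply: (ideal_mul maxM) => //.
        exact: ualg_exp.
      by apply: ualgB => //; exact: ualgC.
    by apply/funext => x; rewrite exprMn; ring.
  have Af (t : R) : A (fun x => 1 - (t%:C * b x) ^+ n).
    by apply: ualgB => //; exact: ualgC.
  have r16 : 16^-1 < 1 :> R by lra.
  have [|g Ag [Mg qg]] := qle_inv ua maxM (Af s) r16.
    by under eq_fun do rewrite opprB addrC subrK.
  have hs : qle M (fun x => h s%:C x - 1) 15^-1.
    apply: (@qle_eqmod _ _ A _ maxM (fun x => g x - 1)).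
      rewrite (_ : (fun x => _) = (fun x => h s%:C x - g x)).
        exact: (inv_mod_uniq ua maxM (Af s)).
      by apply/funext => x; ring.
    by apply: qleW qg; rewrite ler_pdivrMr; lra.
  have hsd : qle M (fun x => 1 - h (s + d)%:C x) 3^-1.
    rewrite (_ : (fun x => _) = (fun x =>
      (h s%:C x - h (s + d)%:C x) + (-1) * (h s%:C x - 1))).
      apply: qleW (qleD maxM (lip _ _) (qleZ ua maxM (-1) hs)).
      rewrite normcNE normc1 mul1r normc_distC -rmorphB /= addrAC subrr add0r.
      rewrite expr0n addr0 sqrtr_sqr gtr0_norm//.
      have -> : K * d = 4^-1 by rewrite /d; field; rewrite gt_eqF.
      lra.
    by apply/funext => x; ring.
  have r3 : 3^-1 < 1 :> R by lra.
  have [g' Ag' [Mg' qg']] := qle_inv ua maxM (Ah _) r3 hsd.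
  exists j.+2; rewrite -/n.
  rewrite (_ : (fun x => _) = (fun x => (-1) *
    ((1 - ((s + d)%:C * b x) ^+ n) - 1))); last by apply/funext => x; ring.
  apply: (@qleW _ _ _ _ (normc (-1 : R[i]) * 2^-1)).
    by rewrite normcNE normc1 mul1r.
  apply: (qleZ ua maxM).
  apply: (@qle_eqmod _ _ A _ maxM (fun x => g' x - 1)); last first.
    by apply: qleW qg'; rewrite ler_pdivrMr; lra.
  rewrite (_ : (fun x => _) =
    (fun x => (1 - ((s + d)%:C * b x) ^+ n) - g' x)).
    apply: (inv_mod_uniq ua maxM (Ah (s + d)%:C)) => //.
    by under eq_fun do rewrite mulrC; exact: hinv.
  by apply/funext => x; ring.
have goodk k : good (d *+ k).
  by elim: k => [|k]; [rewrite mulr0n|rewrite mulrSr; exact: goodS].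
pose k := Num.bound (N / d).
have Nk : N < d *+ k.
  by rewrite -mulr_natl -ltr_pdivrMr//; apply: archi_boundP; rewrite divr_ge0//; lra.
have [j] := goodk k; set s := d *+ k in Nk *; set n := (2 ^ j)%N => sj.
have s0 : s != 0 by rewrite gt_eqF//; lra.
have as1 : qle M (fun x => ((s^-1)%:C * a x) ^+ n) 1.
  apply: (qle_sup maxM) => x; rewrite normcX exprn_ile1 ?normc_ge0//.
  rewrite normcM normc_real gtr0_norm ?invr_gt0; last lra.
  rewrite mulrC ler_pdivrMr; last lra.
  by have := aN x; lra.
have := qleM ua maxM (Asb s n) _ sj as1.
rewrite mulr1 => /(_ (ualg_exp ua n (ualgZ ua _ Aa))) q.
suff : 1 <= 2^-1 :> R by lra.
apply: (qle1 ua maxM); apply: (qle_eqmod maxM _ q).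
rewrite (_ : (fun x => _) = (fun x => (-1) * (b x ^+ n * a x ^+ n - 1))).
  by apply: (idealZ ua maxM); exact: (inv_modX ua maxM).
apply/funext => x; rewrite !exprMn fmorphV exprVn.
have sn0 : (s%:C) ^+ n != 0 :> R[i] by rewrite expf_neq0// fmorph_eq0.
by field.
Qed.

End GelfandMazur.

(** * Characters are points, and regular algebras are normal *)

Section Characters.
Context {R : realType} {X : topologicalType}.
Variable A : set (X -> R[i]).
Hypothesis ua : uniform_algebra A.
Hypothesis rA : regular_algebra A.

Lemma gelfand_continuous (a : A) : continuous (gelfand a).
Proof.
move=> w; apply: (@continuous_comp _ _ _ (set_val : character_space A -> _)
  (fun u : {ptws A -> R[i]} => u a)).
  exact: initial_continuous.
exact: (@proj_continuous _ (fun _ : A => R[i]) a).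
Qed.

Lemma character_space_hausdorff : hausdorff_space (character_space A).
Proof.
move=> v w vw; apply: val_inj; apply/funext => a.
have hC : hausdorff_space R[i] by exact: norm_hausdorff.
apply: (hC (gelfand a v) (gelfand a w)) => U V nU nV.
have [u [Uu Vu]] := vw _ _ (gelfand_continuous nU) (gelfand_continuous nV).
by exists (gelfand a u).
Qed.

Lemma eval_is_character x :
  is_character (fun a : A => set_val a x : R[i]).
Proof.
split=> [a b c abc|k a b ab|a b c abc|].
- by rewrite abc.
- by rewrite ab.
- by rewrite abc.
- by exists (SigSub (mem_set (ualgC ua 1))) => /eqP; rewrite oner_eq0.
Qed.

Definition eval_at x : character_space A :=
  SigSub (mem_set (eval_is_character x)).

Lemma gelfand_eval_at (a : A) x : gelfand a (eval_at x) = set_val a x.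
Proof. by []. Qed.

Lemma eval_at_continuous : continuous eval_at.
Proof.
apply: continuous_comp_initial => x.
apply/cvg_sup => a.
have Aa : A (set_val a) by apply: set_mem; exact: valP.
exact: (continuous_comp_initial (w := fun u : A -> R[i] => u a)
  (ualg_continuous ua Aa)).
Qed.

(** Regularity is used through this lemma only: the evaluations at the points of
a closed set form a compact, hence closed, set of characters. *)
Lemma regular_separation (E : set X) (w : character_space A) :
  closed E -> (forall x, E x -> eval_at x <> w) ->
  exists a : A, (forall x, E x -> set_val a x = 0) /\ gelfand a w = 1.
Proof.
move=> cE Ew.
have cK : compact E.
  by apply: subclosed_compact cE (ualg_compact ua) _.
have cim : closed (eval_at @` E).
  apply: compact_closed; first exact: character_space_hausdorff.
  apply: continuous_compact => //.
  by apply: continuous_subspaceT; exact: eval_at_continuous.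
have [|a [aE aw]] := rA cim (w := w).
  by move=> [x Ex xw]; exact: (Ew x Ex).
exists a; split => // x Ex.
apply: aE; exists (eval_at x) => //; by exists x.
Qed.

Lemma eval_at_inj : injective eval_at.
Proof.
move=> x y xy; apply: contrapT => /(ualg_separates ua)[f Af].
apply; rewrite -[f]/(set_val (SigSub (mem_set Af) : A)).
by rewrite -!gelfand_eval_at xy.
Qed.

(** By the Gelfand-Mazur theorem the quotient by [M] is a character [w]. If [w]
were not an evaluation, regularity would provide an element of [A] that is zero
at all points, hence zero, and equal to [1] at [w]. *)
Lemma maximal_ideal_point (M : set (X -> R[i])) : maximal_ideal A M ->
  exists x, forall f, M f -> f x = 0.
Proof.
move=> maxM.
have eig (a : A) : exists z : R[i], M (fun x => set_val a x - z).
  have Aa : A (set_val a) by apply: set_mem; exact: valP.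
  apply: contrapT => /forallNP noeig.
  exact: (gelfand_mazur_absurd ua maxM Aa noeig).
pose phi (a : A) : R[i] := projT1 (cid (eig a)).
have Mphi (a : A) : M (fun x => set_val a x - phi a) by exact: projT2 (cid (eig a)).
have phi_uniq (a : A) z : M (fun x => set_val a x - z) -> phi a = z.
  move=> Mz; apply/eqP; rewrite -subr_eq0; apply/negP => /negP nz.
  apply: (maximal_proper maxM).
  have := idealZ ua maxM (phi a - z)^-1 (idealB ua maxM Mz (Mphi a)).
  congr (M _); apply/funext => x; field; exact: nz.
have chphi : is_character phi.
  split=> [a b c abc|k a b ab|a b c abc|].
  - apply: phi_uniq; rewrite abc.
    rewrite (_ : (fun x => _) = (fun x => (set_val a x - phi a)
      + (set_val b x - phi b))); first exact: (ideal_add maxM).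
    by apply/funext => x; rewrite fctE; ring.
  - apply: phi_uniq; rewrite ab.
    rewrite (_ : (fun x => _) = (fun x => k * (set_val a x - phi a))).
      exact: (idealZ ua maxM).
    by apply/funext => x; rewrite fctE /GRing.scale/=; ring.
  - apply: phi_uniq; rewrite abc.
    rewrite (_ : (fun x => _) = (fun x => set_val b x * (set_val a x - phi a)
      + (fun=> phi a) x * (set_val b x - phi b))).
      apply: (ideal_add maxM); apply: (ideal_mul maxM) => //.
        by apply: set_mem; exact: valP.
      exact: ualgC.
    by apply/funext => x; rewrite fctE; ring.
  - exists (SigSub (mem_set (ualgC ua 1))); rewrite (phi_uniq _ 1).
      by apply/eqP; exact: oner_neq0.
    by under eq_fun do rewrite subrr; exact: (ideal_zero maxM).
pose w : character_space A := SigSub (mem_set chphi).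
have [[x xw]|/forallNP nx] := pselect (exists x, eval_at x = w).
  exists x => f Mf.
  have Af := ideal_sub maxM Mf.
  pose a : A := SigSub (mem_set Af).
  have : gelfand a (eval_at x) = gelfand a w by rewrite xw.
  rewrite gelfand_eval_at => fx; rewrite -[f x]/(set_val a x) fx.
  by apply: (phi_uniq a); under eq_fun do rewrite subr0.
have [|a [a0 aw]] := @regular_separation setT w closedT.
  by move=> x _; exact: nx.
have : phi a = 0.
  apply: phi_uniq; under eq_fun do rewrite subr0.
  rewrite (_ : set_val a = fun=> 0); first exact: (ideal_zero maxM).
  by apply/funext => x; exact: a0.
by rewrite -[phi a]/(gelfand a w) aw => /eqP; rewrite oner_eq0.
Qed.

(** The sums [f + g] with [f] zero on [E] and [g] zero on [F] form an ideal. It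
has no common zero, so it contains [1], and [1 = f + g] reads [f = 1] on [F]. *)
Lemma regular_normal (E F : set X) : closed E -> closed F ->
  E `&` F = set0 ->
  exists2 f, A f & (forall x, E x -> f x = 0) /\ (forall x, F x -> f x = 1).
Proof.
move=> cE cF EF.
pose I := [set h | exists f g, [/\ A f, A g, (forall x, E x -> f x = 0),
  (forall x, F x -> g x = 0) & h = fun x => f x + g x]].
have in_I f g : A f -> A g -> (forall x, E x -> f x = 0) ->
  (forall x, F x -> g x = 0) -> I (fun x => f x + g x) by move=> *; exists f, g.
have idI : ideal A I.
  split.
  - by move=> _ [f [g [Af Ag _ _ ->]]]; exact: ualgD.
  - rewrite (_ : (fun=> 0) = fun x : X => 0 + 0 : R[i]).
      by apply: in_I => //; exact: ualgC.
    by apply/funext => x; rewrite addr0.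
  - move=> _ _ [f [g [Af Ag fE gF ->]]] [f' [g' [Af' Ag' f'E g'F ->]]].
    rewrite (_ : (fun x => _) = (fun x => (f x + f' x) + (g x + g' x))).
      apply: in_I; [exact: ualgD|exact: ualgD| |] => x ?.
        by rewrite fE// f'E// addr0.
      by rewrite gF// g'F// addr0.
    by apply/funext => x; ring.
  - move=> h _ Ah [f [g [Af Ag fE gF ->]]].
    rewrite (_ : (fun x => _) = (fun x => (h x * f x) + (h x * g x))).
      apply: in_I; [exact: ualgM|exact: ualgM| |] => x ?.
        by rewrite fE// mulr0.
      by rewrite gF// mulr0.
    by apply/funext => x; ring.
have [[f [g [Af Ag fE gF fg]]]|I1] := pselect (I (fun=> 1)).
  exists f => //; split=> // x Fx.
  by have := congr1 (fun u => u x) fg; rewrite /= gF// addr0.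
exfalso; have [M maxM IM] := maximal_ideal_above ua idI I1.
have [x Mx] := maximal_ideal_point maxM.
have sep (S : set X) : closed S -> ~ S x ->
    exists2 a, A a & (forall y, S y -> a y = 0) /\ a x = 1.
  move=> cS Sx; have [|a [aS ax]] := @regular_separation S (eval_at x) cS.
    by move=> y Sy /eval_at_inj yx; apply: Sx; rewrite -yx.
  by exists (set_val a) => //; apply: set_mem; exact: valP.
have A0 : A (fun=> 0) by exact: ualgC.
have [Ex|/(sep _ cE)[a Aa [aE ax]]] := pselect (E x).
  have [|a Aa [aF ax]] := sep _ cF.
    by move=> Fx; have : (E `&` F) x by []; rewrite EF.
  have := Mx _ (IM _ (in_I _ _ A0 Aa (fun _ _ => erefl) aF)).
  by rewrite ax add0r => /eqP; rewrite oner_eq0.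
have := Mx _ (IM _ (in_I _ _ Aa A0 aE (fun _ _ => erefl))).
by rewrite ax addr0 => /eqP; rewrite oner_eq0.
Qed.

End Characters.

(** * Uniform approximation by elements of the algebra on a set *)

Section LocalApproximation.
Context {R : realType} {X : topologicalType}.
Variable A : set (X -> R[i]).
Hypothesis ua : uniform_algebra A.
Implicit Types (S : set X) (f g k : X -> R[i]).

Definition approx_on S g := forall e : R, 0 < e ->
  exists2 k, A k & forall x, S x -> normc (g x - k x) <= e.

Lemma approx_on_lim S g :
  (forall e : R, 0 < e ->
    exists2 h, approx_on S h & forall x, S x -> normc (g x - h x) <= e) ->
  approx_on S g.
Proof.
move=> H e e0; have e20 : 0 < e / 2 by lra.
have [h Sh gh] := H _ e20; have [k Ak hk] := Sh _ e20.
exists k => // x Sx; have := normcD (g x - h x) (h x - k x).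
rewrite addrA subrK; have := gh _ Sx; have := hk _ Sx; lra.
Qed.

Lemma approx_on_alg S f : A f -> approx_on S f.
Proof.
by move=> Af e e0; exists f => // x _; rewrite subrr normc0 ltW.
Qed.

Lemma approx_on_setT g : approx_on setT g -> A g.
Proof.
move=> Sg; apply: (ualg_lim ua) => e /Sg[k Ak gk].
by exists k => // x; exact: gk.
Qed.

Lemma approx_on_subset S T g : S `<=` T -> approx_on T g -> approx_on S g.
Proof.
by move=> ST Tg e /Tg[k Ak gk]; exists k => // x /ST; exact: gk.
Qed.

Lemma approx_on_eq S f g : (forall x, S x -> f x = g x) ->
  approx_on S f -> approx_on S g.
Proof.
by move=> fg Sf e /Sf[k Ak fk]; exists k => // x Sx; rewrite -fg//; exact: fk.
Qed.

Lemma approx_onD S f g : approx_on S f -> approx_on S g ->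
  approx_on S (fun x => f x + g x).
Proof.
move=> Sf Sg e e0; have e20 : 0 < e / 2 by lra.
have [k Ak fk] := Sf _ e20; have [h Ah gh] := Sg _ e20.
exists (fun x => k x + h x) => [|x Sx]; first exact: ualgD.
rewrite opprD addrACA; have := normcD (f x - k x) (g x - h x).
have := fk _ Sx; have := gh _ Sx; lra.
Qed.

Lemma approx_on_bounded S g : approx_on S g ->
  exists2 N : R, 0 < N & forall x, S x -> normc (g x) <= N.
Proof.
move=> Sg; have [k Ak gk] := Sg _ ltr01.
have [N N0 kN] := ualg_bounded ua Ak.
exists (N + 1); first lra.
move=> x Sx; have := normcD (g x - k x) (k x); rewrite subrK.
have := gk _ Sx; have := kN x; lra.
Qed.

Lemma approx_onM S f g : approx_on S f -> approx_on S g ->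
  approx_on S (fun x => f x * g x).
Proof.
move=> Sf Sg e e0.
have [N N0 gN] := approx_on_bounded Sg.
have [k Ak fk] : exists2 k, A k &
    forall x, S x -> normc (f x - k x) <= e / (2 * N).
  by apply: Sf; rewrite divr_gt0// mulr_gt0.
have [K K0 kK] := ualg_bounded ua Ak.
have [h Ah gh] : exists2 h, A h &
    forall x, S x -> normc (g x - h x) <= e / (2 * K).
  by apply: Sg; rewrite divr_gt0// mulr_gt0.
exists (fun x => k x * h x) => [|x Sx]; first exact: ualgM.
rewrite (_ : _ - _ = (f x - k x) * g x + k x * (g x - h x)); last by ring.
apply: (le_trans (normcD _ _)); rewrite !normcM.
have := ler_pM (normc_ge0 _) (normc_ge0 _) (fk _ Sx) (gN _ Sx).
have := ler_pM (normc_ge0 _) (normc_ge0 _) (kK x) (gh _ Sx).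
have -> : K * (e / (2 * K)) = e / 2 by field; rewrite gt_eqF.
have -> : e / (2 * N) * N = e / 2 by field; rewrite gt_eqF.
lra.
Qed.

Lemma approx_onZ S (c : R[i]) f : approx_on S f -> approx_on S (fun x => c * f x).
Proof.
by apply: approx_onM; apply: approx_on_alg; exact: ualgC.
Qed.

Lemma approx_on_continuous S g : approx_on S g -> forall x, S x ->
  forall e : R, 0 < e -> \forall y \near x, S y -> normc (g x - g y) < e.
Proof.
move=> Sg x Sx e e0; have e40 : 0 < e / 4 by lra.
have [k Ak gk] := Sg _ e40.
have ck := ualg_continuous ua Ak; have /cvgcP/(_ _ e40) := ck x.
apply: filterS => y kxy Sy.
rewrite (_ : g x - g y = (g x - k x) + (k x - k y) - (g y - k y)); last by ring.
have := normcB ((g x - k x) + (k x - k y)) (g y - k y).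
have := normcD (g x - k x) (k x - k y).
have := gk _ Sx; have := gk _ Sy; move: kxy; lra.
Qed.

(** The cutoff must be exactly [0] and [1] on the two outer parts, because
nothing bounds the approximants outside the sets where they approximate [g]. *)
Lemma approx_on_glue (P O Q : set X) g :
  (exists2 f, A f & (forall x, Q x -> f x = 0) /\ (forall x, P x -> f x = 1)) ->
  approx_on (P `|` O) g -> approx_on (O `|` Q) g -> approx_on (P `|` O `|` Q) g.
Proof.
move=> [c Ac [cQ cP]] g1 g2 e e0.
have [N N0 cN] := ualg_bounded ua Ac.
have d0 : 0 < e / (2 * N + 1) by rewrite divr_gt0//; lra.
have [k1 Ak1 gk1] := g1 _ d0; have [k2 Ak2 gk2] := g2 _ d0.
have de : e / (2 * N + 1) <= e by rewrite ler_pdivrMr ?ler_peMr//; lra.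
exists (fun x => c x * k1 x + (1 - c x) * k2 x).
  apply: (ualgD ua); apply: (ualgM ua) => //.
  by apply: (ualgB ua) => //; exact: ualgC.
move=> x; case=> [[Px|Ox]|Qx].
- rewrite cP// subrr mul1r mul0r addr0; apply: le_trans de.
  by apply: gk1; left.
- have H1 := gk1 x (or_intror Ox); have H2 := gk2 x (or_introl Ox).
  rewrite (_ : _ - _ = c x * (g x - k1 x) + (1 - c x) * (g x - k2 x)); last by ring.
  apply: (le_trans (normcD _ _)); rewrite !normcM.
  have N1 : normc (1 - c x) <= 1 + N.
    by have := normcB 1 (c x); rewrite normc1; have := cN x; lra.
  have := ler_pM (normc_ge0 _) (normc_ge0 _) (cN x) H1.
  have := ler_pM (normc_ge0 _) (normc_ge0 _) N1 H2.
  have : e = (2 * N + 1) * (e / (2 * N + 1)) by field; rewrite gt_eqF//; lra.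
  set d := e / _; lra.
- rewrite cQ// mul0r add0r subr0 mul1r; apply: le_trans de.
  by apply: gk2; right.
Qed.

Lemma exists_root_right (z : R[i]) : exists2 w : R[i], w ^+ 2 = z &
  0 <= complex.Re w.
Proof.
have [H|H] := leP 0 (complex.Re (sqrtc z)).
  by exists (sqrtc z) => //; exact: sqr_sqrtc.
exists (- sqrtc z); first by rewrite sqrrN sqr_sqrtc.
by case: (sqrtc z) H => a b /=; rewrite oppr_ge0 => /ltW.
Qed.

(** The iteration [G := G + (v - G ^ 2) / 2] computes a square root by polynomials
in [v]: the error [s - G] is multiplied by [1 - (s + G) / 2], of modulus at most
[1/2] as long as [s] and [G] stay near [1]. *)
Lemma approx_on_sqrt_near1 S v : approx_on S v ->
  (forall x, S x -> normc (v x - 1) <= 4^-1) ->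
  exists2 g, approx_on S g & forall x, S x -> g x ^+ 2 = v x.
Proof.
move=> Sv v1.
pose s x := s2val (cid2 (exists_root_right (v x))).
have ss x : s x ^+ 2 = v x by exact: (s2valP (cid2 (exists_root_right (v x)))).
have sRe x : 0 <= complex.Re (s x) by exact: (s2valP' (cid2 (exists_root_right (v x)))).
have s1 x : S x -> normc (s x - 1) <= 4^-1.
  move=> /v1; rewrite -ss (_ : _ - 1 = (s x - 1) * (s x + 1)); last by ring.
  rewrite normcM; apply: le_trans; rewrite ler_peMr ?normc_ge0//.
  apply: le_trans (normc_Re _); rewrite raddfD /=.
  by rewrite ger0_norm; have := sRe x; lra.
exists s; last by move=> x _; exact: ss.
pose G := fix G n x := if n is n'.+1 then G n' x + 2^-1 * (v x - G n' x ^+ 2) else 1.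
have SG n : approx_on S (G n).
  elim: n => [|n IH]; first by apply: approx_on_alg; exact: ualgC.
  apply: approx_onD => //; apply: approx_onZ; apply: approx_onD => //.
  apply: (@approx_on_eq _ (fun x => (-1) * (G n x * G n x))).
    by move=> x _; rewrite mulN1r.
  by apply: approx_onZ; exact: approx_onM.
have sG n x : S x -> normc (s x - G n x) <= 4^-1 * 2^-1 ^+ n.
  move=> Sx; have s1x := s1 _ Sx; elim: n => [|n IH].
    by rewrite expr0 mulr1.
  rewrite [G _ _]/= -/(G n x) -ss.
  rewrite (_ : _ - _ = (s x - G n x) * (2^-1 * ((1 - s x) + (1 - G n x)))); last first.
    by field.
  rewrite exprSr mulrA normcM; apply: ler_pM; rewrite ?normc_ge0//.
  have h2 : normc (2^-1 : R[i]) = 2^-1.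
    rewrite (_ : 2^-1 = (2^-1)%:C); last by rewrite fmorphV rmorph_nat.
    by rewrite normc_real ger0_norm// invr_ge0.
  rewrite normcM h2 -[leRHS]mulr1; apply: ler_wpM2l; first by rewrite invr_ge0.
  have G1 : normc (s x - G n x) <= 4^-1.
    apply: (le_trans IH); rewrite ler_piMr ?invr_ge0//.
    by apply: exprn_ile1; rewrite ?invr_ge0//; lra.
  have := normcD (1 - s x) (1 - G n x).
  have := normcD (1 - s x) (s x - G n x); rewrite addrA subrK.
  rewrite (normc_distC 1 (s x)); lra.
apply: approx_on_lim => e e0.
have : (fun n => 2^-1 ^+ n) @ \oo --> (0 : R).
  by apply: cvg_expr; rewrite ger0_norm ?invr_ge0//; lra.
move=> /cvgrPdist_lt/(_ _ e0) [n _ /(_ n (leqnn n))] /=.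
rewrite sub0r normrN ger0_norm ?exprn_ge0 ?invr_ge0// => en.
exists (G n) => // x Sx; have H := sG n _ Sx; apply: (le_trans H).
have : 0 <= 2^-1 ^+ n :> R by rewrite exprn_ge0// invr_ge0.
lra.
Qed.

Lemma approx_on_sqrt_near S v (c : R[i]) : c != 0 -> approx_on S v ->
  (forall x, S x -> normc (v x - c) <= 4^-1 * normc c) ->
  exists2 g, approx_on S g & forall x, S x -> g x ^+ 2 = v x.
Proof.
move=> c0 Sv vc.
have [|x Sx|g Sg gv] := @approx_on_sqrt_near1 S (fun x => c^-1 * v x).
- exact: approx_onZ.
- rewrite (_ : _ - 1 = c^-1 * (v x - c)); last by rewrite mulrBr mulVf.
  by rewrite normcM normcV mulrC ler_pdivrMr ?normc_gt0// vc.
exists (fun x => sqrtc c * g x); first exact: approx_onZ.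
by move=> x Sx; rewrite exprMn sqr_sqrtc gv// mulrA mulfV// mul1r.
Qed.

Lemma connected_positive S (u : X -> R) : connected S ->
  {within S, continuous u} -> (forall x, S x -> u x != 0) ->
  forall p, S p -> 0 < u p -> forall x, S x -> 0 < u x.
Proof.
move=> cS cu u0 p Sp up x Sx; rewrite ltNge; apply/negP => ux.
have /connected_intervalP iu := connected_continuous_connected cS cu.
have [y Sy uy] : (u @` S) 0.
  apply: (iu (u x) (u p)); [by exists x|by exists p|].
  by rewrite ux ltW.
by have := u0 _ Sy; rewrite uy eqxx.
Qed.

(** Of two functions that never satisfy [|f - g| = |f + g|], for instance two
square roots of a nowhere zero function, [f] stays on the side of [g] or on the
side of [- g] throughout a connected set. *)
Lemma connected_sign S f g : connected S -> approx_on S f -> approx_on S g ->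
  (forall x, S x -> normc (f x - g x) != normc (f x + g x)) ->
  forall p, S p -> normc (f p - g p) < normc (f p + g p) ->
  forall x, S x -> normc (f x - g x) < normc (f x + g x).
Proof.
move=> cS Sf Sg fg p Sp fgp x Sx; rewrite -subr_gt0.
apply: (@connected_positive S (fun x => normc (f x + g x) - normc (f x - g x)))
  Sp _ _ Sx => //; last first.
- by rewrite subr_gt0.
- by move=> y Sy; rewrite subr_eq0 eq_sym fg.
apply/subspace_continuousP => y Sy; apply/cvgrPdist_lt => e e0.
have e40 : 0 < e / 4 by lra.
have fy := approx_on_continuous Sf Sy e40.
have gy := approx_on_continuous Sg Sy e40.
rewrite near_withinE; near=> z => Sz.
have fyz : normc (f y - f z) < e / 4 by move: Sz; near: z.
have gyz : normc (g y - g z) < e / 4 by move: Sz; near: z.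
have lip (a b : R[i]) : normc a <= normc b + normc (a - b).
  by have := normcD b (a - b); rewrite addrC subrK.
have sum_le : normc ((f y + g y) - (f z + g z)) <=
    normc (f y - f z) + normc (g y - g z).
  by rewrite opprD addrACA; exact: normcD.
have dif_le : normc ((f y - g y) - (f z - g z)) <=
    normc (f y - f z) + normc (g y - g z).
  by rewrite opprD addrACA -opprD; exact: normcB.
have := lip (f y + g y) (f z + g z); have := lip (f z + g z) (f y + g y).
have := lip (f y - g y) (f z - g z); have := lip (f z - g z) (f y - g y).
rewrite (normc_distC (f z + g z)) (normc_distC (f z - g z)) ltr_norml.
by move=> *; apply/andP; rewrite /from_subspace; split; lra.
Unshelve. all: by end_near.
Qed.

End LocalApproximation.

(** * Approximation on arcs *)

Section Intervals.
Context {R : realType}.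
Implicit Types a b : R.

(** Lebesgue's number lemma for a segment, stated for pairs of points so that it
also serves as the uniform continuity theorem. *)
Lemma lebesgue_number a b (P : R -> R -> Prop) :
  (forall c, a <= c <= b -> exists2 d : R, 0 < d & forall s t,
     a <= s <= b -> a <= t <= b -> `|c - s| < d -> `|c - t| < d -> P s t) ->
  exists2 d : R, 0 < d & forall s t,
    a <= s <= b -> a <= t <= b -> `|s - t| <= d -> P s t.
Proof.
move=> locP.
have cab := iffLR (compact_near_coveringP _) (@segment_compact R a b).
have [] := cab R 0^'+ (fun d s => a <= s <= b ->
    forall t, a <= t <= b -> `|s - t| <= d -> P s t) _ _.
  move=> c; rewrite /= in_itv /= => cI.
  have [d d0 Pd] := locP _ cI.
  exists ([set s | `|c - s| < d / 2], [set r | r < d / 2]).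
    split; first by apply: (@nbhsx_ballx R R); rewrite divr_gt0.
    by apply: nbhs_right_lt; rewrite divr_gt0.
  move=> [s r] /= [cs rd] sI t tI st; apply: Pd => //; first lra.
  by have := ler_distD s c t; lra.
move=> d /= d0 Pd; exists (d / 2) => [|s t sI tI st]; first by rewrite divr_gt0.
have d20 : 0 < d / 2 by rewrite divr_gt0.
have dd : `|0 - d / 2| < d by rewrite sub0r normrN gtr0_norm//; lra.
by apply: (Pd _ dd d20 s); rewrite ?in_itv.
Qed.

Lemma creeping a b d (P : R -> Prop) : a <= b -> 0 < d -> P a ->
  (forall s t, a <= s -> s < t -> t <= b -> t <= s + d -> P s -> P t) -> P b.
Proof.
move=> ab d0 Pa PS.
have H n : P (Num.min b (a + d *+ n)).
  elim: n => [|n IH]; first by rewrite mulr0n addr0 min_r.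
  have [bn|nb] := leP b (a + d *+ n).
    rewrite min_l; first by move: IH; rewrite min_l.
    by rewrite mulrSr; lra.
  rewrite min_r in IH; last exact: ltW.
  apply: PS IH.
  - by rewrite lerDl mulrn_wge0// ltW.
  - by rewrite lt_min nb mulrSr /=; lra.
  - by rewrite ge_min lexx.
  - by rewrite ge_min mulrSr addrA lexx orbT.
have := H (Num.bound ((b - a) / d)); rewrite min_l//.
rewrite -lerBlDl -mulr_natl -ler_pdivrMr// ltW//.
by apply: archi_boundP; rewrite divr_ge0//; lra.
Qed.

End Intervals.

Section Arcs.
Context {R : realType} {X : topologicalType}.
Variable A : set (X -> R[i]).
Hypothesis ua : uniform_algebra A.
Hypothesis rA : regular_algebra A.
Hypothesis dA : dense_invertible_group A.
Variable c : R -> X.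
Hypothesis cc : continuous c.
Hypothesis ci : injective c.

Definition subarc (a b : R) := c @` `[a, b].

Lemma in_arc a b t : a <= t <= b -> subarc a b (c t).
Proof. by move=> tab; exists t => //=; rewrite in_itv. Qed.

Lemma arcP a b x : subarc a b x -> exists2 t, a <= t <= b & x = c t.
Proof. by case=> t; rewrite /= in_itv => tab <-; exists t. Qed.

Lemma arc_subset a b a' b' : a' <= a -> b <= b' -> subarc a b `<=` subarc a' b'.
Proof. by move=> aa bb x /arcP[t tab ->]; apply: in_arc; lra. Qed.

Lemma arc_compact a b : compact (subarc a b).
Proof.
apply: continuous_compact; last exact: segment_compact.
exact: continuous_subspaceT.
Qed.

Lemma arc_connected a b : connected (subarc a b).
Proof.
apply: connected_continuous_connected; first exact: segment_connected.
exact: continuous_subspaceT.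
Qed.

Lemma arc_cutoff a s t b : s < t ->
  exists2 f, A f & (forall x, subarc a s x -> f x = 0) /\
                   (forall x, subarc t b x -> f x = 1).
Proof.
move=> st; apply: (regular_normal ua rA).
- exact: compact_closed (ualg_hausdorff ua) (@arc_compact _ _).
- exact: compact_closed (ualg_hausdorff ua) (@arc_compact _ _).
rewrite -subset0 => _ [/arcP[u us ->] /arcP[v tv]].
by move=> /ci uv; lra.
Qed.

Lemma arc_near (g : X -> R[i]) a b u e : approx_on A (subarc a b) g ->
  a <= u <= b -> 0 < e -> exists2 d : R, 0 < d & forall s, a <= s <= b ->
    `|u - s| < d -> normc (g (c u) - g (c s)) < e.
Proof.
move=> Sg uI e0; have := approx_on_continuous ua Sg (in_arc uI) e0.
move=> /cc /nbhs_ballP[d /= d0 dB]; exists d => // s sI us.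
by apply: dB; [exact: us|exact: in_arc].
Qed.

Lemma arc_small_oscillation (g : X -> R[i]) a b : approx_on A (subarc a b) g ->
  (forall x, subarc a b x -> g x != 0) ->
  exists2 d : R, 0 < d & forall s t, a <= s <= b -> a <= t <= b ->
    `|s - t| <= d -> normc (g (c t) - g (c s)) <= 4^-1 * normc (g (c s)).
Proof.
move=> Sg g0; apply: lebesgue_number => u uI.
have m0 : 0 < normc (g (c u)) by rewrite normc_gt0 g0//; exact: in_arc.
have m0' : 0 < normc (g (c u)) / 16 by rewrite divr_gt0.
have [d d0 dP] := arc_near Sg uI m0'.
exists d => // s t sI tI us ut.
have := dP _ sI us; have := dP _ tI ut.
rewrite (normc_distC (g (c u)) (g (c t))).
have := normcD (g (c t) - g (c u)) (g (c u) - g (c s)).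
rewrite addrA subrK.
have := normcD (g (c u) - g (c s)) (g (c s)); rewrite subrK.
lra.
Qed.

(** The root is extended from [c @` [a, s]] to [c @` [a, t]]. The root [h] on the
short arc from [r] to [t] is normalised to agree with [g] at [c s], hence on
the overlap by connectedness; the overlap is what the gluing lemma requires. *)
Lemma approx_on_arc_sqrt (v : X -> R[i]) a b : a <= b ->
  approx_on A (subarc a b) v -> (forall x, subarc a b x -> v x != 0) ->
  exists2 g, approx_on A (subarc a b) g & forall x, subarc a b x -> g x ^+ 2 = v x.
Proof.
move=> ab Sv v0.
have [d d0 osc] := arc_small_oscillation Sv v0.
have local_root u s t : a <= u <= b -> a <= s -> t <= b -> u - d <= s ->
    t <= u + d ->
    exists2 g, approx_on A (subarc s t) g & forall x, subarc s t x -> g x ^+ 2 = v x.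
  move=> uI sa tb us tu.
  apply: (approx_on_sqrt_near ua (v0 _ (in_arc uI))).
    exact: approx_on_subset (arc_subset sa tb) Sv.
  by move=> x /arcP[r rI ->]; apply: osc => //; [lra|rewrite ler_norml; lra].
pose P s := exists2 g, approx_on A (subarc a s) g &
  forall x, subarc a s x -> g x ^+ 2 = v x.
apply: (@creeping _ a b d P) => //.
  by apply: (local_root a); lra.
move=> s t sa st tb td [g Sg gv].
(* If [s - d < a], the overlap is all of the arc on which [g] is known. *)
pose r := Num.max a (s - d).
have rs : r <= s by rewrite ge_max sa; lra.
have ra : a <= r by rewrite le_max lexx.
have rd : s - d <= r by rewrite le_max lexx orbT.
have [h0 Sh0 h0v] : exists2 g, approx_on A (subarc r t) g &
  forall x, subarc r t x -> g x ^+ 2 = v x by apply: (local_root s); lra.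
have [h [Sh hv hs]] : exists h, [/\ approx_on A (subarc r t) h,
    forall x, subarc r t x -> h x ^+ 2 = v x & h (c s) = g (c s)].
  have [] := @sqr_eq_sign R (g (c s)) (h0 (c s)).
  - by rewrite gv ?h0v//; apply: in_arc; lra.
  - by exists h0.
  - move=> gh; exists (fun x => (-1) * h0 x); split.
    + exact: approx_onZ.
    + by move=> x /h0v <-; rewrite mulN1r sqrrN.
    + by rewrite gh mulN1r.
have gh x : subarc r s x -> g x = h x.
  move=> rsx.
  have Pg y : subarc r s y -> g y ^+ 2 = v y.
    by move=> ry; apply: gv; exact: arc_subset ry.
  have Ph y : subarc r s y -> h y ^+ 2 = v y.
    by move=> ry; apply: hv; apply: arc_subset ry => //; exact: ltW.
  have nz y : subarc r s y -> g y != 0.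
    move=> ry; apply/negP => /eqP gy.
    have : v y != 0 by apply: v0; apply: arc_subset ry => //; lra.
    by rewrite -Pg// gy expr0n eqxx.
  have n2 y : subarc r s y -> 0 < normc (g y + g y).
    move=> ry; rewrite -mulr2n normcMn pmulrn_lgt0// normc_gt0.
    exact: nz.
  have [] := @sqr_eq_sign R (g x) (h x) => //.
    by rewrite Pg// Ph.
  move=> gN; exfalso.
  have : normc (g x - h x) < normc (g x + h x).
    apply: (@connected_sign _ _ _ ua (subarc r s) g h _ _ _ _ (c s)) => //.
    - exact: arc_connected.
    - by apply: approx_on_subset Sg; exact: arc_subset.
    - by apply: approx_on_subset Sh; apply: arc_subset => //; exact: ltW.
    - move=> y ry; have [|->|hy] := @sqr_eq_sign R (h y) (g y).
      + by rewrite Pg// Ph.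
      + by rewrite subrr normc0 lt_eqF// n2.
      + by rewrite hy subrr normc0 opprK gt_eqF// n2.
    - by apply: in_arc; rewrite rs lexx.
    - rewrite hs subrr normc0 n2//.
      by apply: in_arc; rewrite rs lexx.
  rewrite (_ : h x = - g x); last by rewrite gN opprK.
  rewrite opprK subrr normc0 ltNge => /negP; apply; exact: normc_ge0.
pose k x := if x \in subarc a s then g x else h x.
have kg x : subarc a s x -> k x = g x by move=> ax; rewrite /k mem_set.
have kh x : subarc r t x -> k x = h x.
  rewrite /k; case: ifPn => // /set_mem/arcP[y ys ->] /arcP[z zt].
  move=> /ci yz; apply: gh; apply: in_arc; lra.
have cover : subarc a t `<=` subarc a (s - d) `|` subarc r s `|` subarc s t.
  move=> x /arcP[y yt ->].
  have [ys|sy] := leP s y; first by right; apply: in_arc; lra.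
  have [yd|dy] := leP y (s - d); first by left; left; apply: in_arc; lra.
  by left; right; apply: in_arc; rewrite ge_max; lra.
exists k; last first.
  move=> x /arcP[y yt ->].
  have [ys|sy] := leP y s.
    have aI : subarc a s (c y) by apply: in_arc; lra.
    by rewrite kg// gv.
  have aI : subarc r t (c y) by apply: in_arc; lra.
  by rewrite kh// hv.
apply: approx_on_subset cover _.
apply: (approx_on_glue ua).
- have [f Af [f0 f1]] : exists2 f, A f & (forall x, subarc a (s - d) x -> f x = 0) /\
      (forall x, subarc s t x -> f x = 1) by apply: arc_cutoff; lra.
  exists (fun x => 1 - f x); first by apply: ualgB => //; exact: ualgC.
  by split=> x Sx; [rewrite f1// subrr|rewrite f0// subr0].
- apply: (@approx_on_eq _ _ _ _ g).
    move=> x; case=> [/arcP[y yI ->]|/arcP[y yI ->]];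
      rewrite kg//; apply: in_arc; lra.
  apply: approx_on_subset Sg.
  by rewrite subUset; split; apply: arc_subset => //; lra.
- apply: (@approx_on_eq _ _ _ _ h).
    move=> x; case=> [/arcP[y yI ->]|/arcP[y yI ->]];
      rewrite kh//; apply: in_arc; lra.
  apply: approx_on_subset Sh.
  by rewrite subUset; split; apply: arc_subset => //; lra.
Qed.

(** Closeness to [1] survives square roots: where [|w - 1| < |w + 1|] one has
[|w + 1| >= 1], so that [|w - 1| <= |w ^ 2 - 1|]; by connectedness the right
sign at one point of the arc from [t] to [b] is right on all of it. *)
Lemma approx_on_arc_root (v : X -> R[i]) a t b (r : R) k :
  a <= t -> t <= b -> r < 1 ->
  approx_on A (subarc a b) v -> (forall x, subarc a b x -> v x != 0) ->
  (forall x, subarc t b x -> normc (v x - 1) <= r) ->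
  exists2 h, approx_on A (subarc a b) h &
    (forall x, subarc a b x -> h x ^+ (2 ^ k) = v x) /\
    (forall x, subarc t b x -> normc (h x - 1) <= r).
Proof.
move=> at_ tb r1 Sv v0 v1; elim: k => [|k [h Sh [hv h1]]].
  by exists v => //; split=> // x _; rewrite expr1.
have ab : a <= b by exact: le_trans tb.
have h0 x : subarc a b x -> h x != 0.
  move=> ax; apply/negP => /eqP hx; have := v0 _ ax.
  by rewrite -hv// hx expr0n expn_eq0 eqxx.
have [w0 Sw0 w0h] := approx_on_arc_sqrt ab Sh h0.
have tab : subarc t b `<=` subarc a b by exact: arc_subset.
have neq (w : X -> R[i]) x : w x ^+ 2 = h x -> subarc t b x ->
    normc (w x - 1) != normc (w x + 1).
  move=> wh tx; apply/eqP => wE.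
  have := h1 _ tx; rewrite -wh (_ : _ - 1 = (w x - 1) * (w x + 1)); last by ring.
  rewrite normcM wE => H.
  have := normcB (w x + 1) (w x - 1).
  rewrite (_ : w x + 1 - (w x - 1) = 2%:C); last by rewrite rmorph_nat; ring.
  rewrite normc_real ger0_norm// wE => H2.
  have : 1 <= normc (w x + 1) by lra.
  nra.
have tI : subarc t b (c t) by apply: in_arc; lra.
have [w [Sw wh wt]] : exists w, [/\ approx_on A (subarc a b) w,
    forall x, subarc a b x -> w x ^+ 2 = h x &
    normc (w (c t) - 1) < normc (w (c t) + 1)].
  have := neq w0 _ (w0h _ (tab _ tI)) tI.
  rewrite neq_lt => /orP[H|H]; first by exists w0.
  exists (fun x => (-1) * w0 x); split; first exact: approx_onZ.
    by move=> x ax; rewrite mulN1r sqrrN w0h.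
  by rewrite mulN1r -opprD normcNE addrC -[_ + 1]opprK opprD opprK normcNE addrC.
exists w => //; split=> x; first by move=> ax; rewrite expnS exprM wh// hv.
move=> tx.
have : normc (w x - 1) < normc (w x + 1).
  apply: (@connected_sign _ _ _ ua (subarc t b) w (fun=> 1) _ _ _ _ (c t)) => //.
  - exact: arc_connected.
  - exact: approx_on_subset Sw.
  - by apply: approx_on_alg; exact: ualgC.
  - by move=> y ty; apply: neq => //; apply: wh; exact: tab.
have := h1 _ tx; rewrite -wh; last exact: tab.
rewrite (_ : _ - 1 = (w x - 1) * (w x + 1)); last by ring.
rewrite normcM => H H2.
have := normcB (w x + 1) (w x - 1).
rewrite (_ : w x + 1 - (w x - 1) = 2%:C); last by rewrite rmorph_nat; ring.
rewrite normc_real ger0_norm// => H3.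
have : 1 <= normc (w x + 1) by lra.
have := normc_ge0 (w x - 1); nra.
Qed.

(** Approximate step functions. The constant [2] is a bound for the
[2 ^ k]-th root of any number below [2 ^ (2 ^ k)], whatever the norm of the
cutoff [f]; it does not depend on [s], [t] and [e], which is the point. *)
Lemma approx_on_arc_step a s t b (e : R) : a <= s -> s < t -> t <= b -> 0 < e ->
  exists2 h, approx_on A (subarc a b) h &
    [/\ forall x, subarc a s x -> normc (h x) <= e,
        forall x, subarc t b x -> normc (h x - 1) <= e &
        forall x, subarc a b x -> normc (h x) <= 2].
Proof.
move=> as_ st tb e0.
have [f Af [f0 f1]] := arc_cutoff a b st.
have [N N0 fN] := ualg_bounded ua Af.
pose k := Num.bound (N + 1).
have Nk : N + 1 <= 2 ^+ (2 ^ k).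
  have : N + 1 < k%:R by apply: archi_boundP; lra.
  move/ltW/le_trans; apply; rewrite -natrX ler_nat.
  by rewrite ltnW// (ltn_trans (ltn_expl k (ltnSn 1)))// ltn_expl.
pose e1 := Num.min e 2^-1.
have e10 : 0 < e1 by rewrite lt_min e0 /= invr_gt0.
have e1e : e1 <= e by rewrite ge_min lexx.
have e11 : e1 <= 2^-1 by rewrite ge_min lexx orbT.
(* [k] is fixed before the perturbation of [f], whose size [r] has root [e1]. *)
pose r := e1 ^+ (2 ^ k).
have r0 : 0 < r by rewrite exprn_gt0.
have re : r <= e1.
  have p0 : (0 < 2 ^ k)%N by rewrite expn_gt0.
  rewrite /r -(prednK p0) exprS; apply: ler_piMr; first exact: ltW.
  by apply: exprn_ile1; lra.
have [g Ag [g0 fg]] := dense_nowhere_zero dA Af r0.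
have [||||||h Sh [hg h1]] := @approx_on_arc_root g a t b r k.
- lra.
- exact: tb.
- lra.
- exact: approx_on_alg.
- by move=> x _; exact: g0.
- by move=> x tx; rewrite normc_distC -(f1 _ tx) ltW.
exists h => //; split=> x xI.
- have xab : subarc a b x by apply: arc_subset xI => //; lra.
  apply: le_trans e1e; rewrite -(@ler_pXn2r _ (2 ^ k))// ?nnegrE ?normc_ge0//;
    rewrite ?expn_gt0//; last lra.
  by rewrite -normcX hg// -normcNE -[- g x]add0r -(f0 _ xI) ltW.
- by apply: (le_trans (h1 _ xI)); lra.
- rewrite -(@ler_pXn2r _ (2 ^ k)) ?expn_gt0// ?nnegrE ?normc_ge0//.
  rewrite -normcX hg//; apply: le_trans Nk.
  have := normcB (f x) (f x - g x); rewrite opprB addrC subrK.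
  have := fN x; have := fg x; lra.
Qed.

(** A staircase is built along the arc, one approximate step at a time. At [s] it
follows [F] before [s] and remains near [F (c s)] after [s]; the next step
has height at most [e], and only between [s] and [t] is its value uncontrolled,
where the bound [2] costs [2 * e]. *)
Lemma approx_on_arc (F : X -> R[i]) a b : a <= b -> continuous F ->
  approx_on A (subarc a b) F.
Proof.
move=> ab cF; apply: approx_on_lim => e4 e40.
pose e := e4 / 4; have e0 : 0 < e by rewrite divr_gt0.
have [d d0 osc] : exists2 d : R, 0 < d & forall s t,
    a <= s <= b -> a <= t <= b -> `|s - t| <= d ->
    normc (F (c s) - F (c t)) <= e.
  apply: lebesgue_number => u uI.
  have cFu : {for u, continuous (F \o c)}.
    by apply: continuous_comp; [exact: cc|exact: cF].
  have e20 : 0 < e / 2 by lra.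
  have /cvgcP/(_ _ e20)/nbhs_ballP[d /= d0 dB] := cFu.
  exists d => // s t _ _ us ut.
  have := dB s us; have := dB t ut; rewrite /= => H1 H2.
  rewrite (_ : _ - _ = (F (c u) - F (c t)) - (F (c u) - F (c s))); last by ring.
  have := normcB (F (c u) - F (c t)) (F (c u) - F (c s)); lra.
pose P s := forall e' : R, 0 < e' -> exists2 k, approx_on A (subarc a b) k &
  (forall x, subarc a s x -> normc (F x - k x) <= 3 * e + e') /\
  (forall x, subarc s b x -> normc (k x - F (c s)) <= e').
suff /(_ e e0)[k Sk [kF _]] : P b.
  by exists k => // x /kF; rewrite /e; lra.
apply: (@creeping _ a b d P) => //.
  move=> e' e'0; exists (fun=> F (c a)).
    by apply: approx_on_alg; exact: ualgC.
  split=> x; last by rewrite subrr normc0 ltW.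
  move=> /arcP[t ta ->]; have -> : t = a by lra.
  by rewrite subrr normc0; lra.
move=> s t as_ st tb td Ps e' e'0.
have e'20 : 0 < e' / 2 by lra.
have [k Sk [kF kc]] := Ps _ e'20.
have e''0 : 0 < e' / (2 * e) by rewrite divr_gt0// mulr_gt0.
have [h Sh [h0 h1 h2]] := approx_on_arc_step as_ st tb e''0.
have D : normc (F (c t) - F (c s)) <= e.
  by apply: osc; rewrite ?ler_norml; lra.
have De : e * (e' / (2 * e)) = e' / 2 by field; rewrite gt_eqF.
exists (fun x => k x + (F (c t) - F (c s)) * h x).
  apply: approx_onD => //; exact: approx_onZ.
split=> x; last first.
  move=> tx; have sx : subarc s b x by apply: arc_subset tx => //; exact: ltW.
  rewrite (_ : _ - _ = (k x - F (c s)) + (F (c t) - F (c s)) * (h x - 1)); last by ring.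
  apply: (le_trans (normcD _ _)); rewrite normcM.
  have := ler_pM (normc_ge0 _) (normc_ge0 _) D (h1 _ tx).
  rewrite De; have := kc _ sx; lra.
rewrite opprD addrA.
have trg := normcB (F x - k x) ((F (c t) - F (c s)) * h x).
rewrite normcM in trg.
move=> /arcP[u uI xu]; have [us|su] := leP u s.
  have sx : subarc a s x by rewrite xu; apply: in_arc; lra.
  have := ler_pM (normc_ge0 _) (normc_ge0 _) D (h0 _ sx).
  rewrite De; have := kF _ sx; lra.
have abx : subarc a b x by rewrite xu; apply: in_arc; lra.
have sbx : subarc s b x by rewrite xu; apply: in_arc; lra.
have := ler_pM (normc_ge0 _) (normc_ge0 _) D (h2 _ abx).
have := kc _ sbx.
have : normc (F x - F (c s)) <= e.
  by rewrite xu; apply: osc; rewrite ?ler_norml; lra.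
have := normcB (F x - F (c s)) (k x - F (c s)).
rewrite opprB addrA subrK.
lra.
Qed.

End Arcs.

(** * The circle *)

Section Circle.
Context {R : realType}.
Implicit Types s t : R.

(** The Cayley transform parametrises the circle minus [-1] by the line, and
[circle_arc z] is its rotation, which misses [- z]. It needs neither
trigonometric functions nor their periodicity. *)
Definition cayley s : R[i] := (1 +i* s) / (1 -i* s).

Lemma normc_cayley_den s : 1 <= normc (1 -i* s).
Proof. by have := normc_Re (1 -i* s); rewrite /= normr1. Qed.

Lemma cayley_den_neq0 s : 1 -i* s != 0 :> R[i].
Proof. by rewrite -normc_gt0; have := normc_cayley_den s; lra. Qed.

Lemma normc_cayley s : normc (cayley s) = 1.
Proof.
have d0 : normc (1 -i* s) != 0 by rewrite normc_eq0 cayley_den_neq0.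
rewrite /cayley normcM normcV.
have -> : normc (1 +i* s) = normc (1 -i* s) by rewrite /= sqrrN.
by rewrite divff.
Qed.

Lemma cayley_eq s t (a b : R[i]) : a * cayley s = b * cayley t ->
  a * (1 +i* s) * (1 -i* t) = b * (1 +i* t) * (1 -i* s).
Proof.
have cayleyE u : cayley u * (1 -i* u) = 1 +i* u.
  by rewrite /cayley divfK// cayley_den_neq0.
by move=> ab; rewrite -(cayleyE s) -(cayleyE t) (mulrA a (cayley s)) (mulrA b (cayley t)) ab mulrAC.
Qed.

(** Because [cayley s = 2 / (1 -i* s) - 1]. *)
Lemma cayley_lipschitz s t : normc (cayley s - cayley t) <= 2 * `|s - t|.
Proof.
have sd := cayley_den_neq0 s; have td := cayley_den_neq0 t.
have -> : cayley s - cayley t =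
    (0 +i* (2 * (s - t))) / ((1 -i* s) * (1 -i* t)).
  have -> : 0 +i* (2 * (s - t)) =
      (1 +i* s) * (1 -i* t) - (1 +i* t) * (1 -i* s) :> R[i].
    by apply/eqP; rewrite eq_complex; apply/andP; split; apply/eqP;
      rewrite /=; ring.
  by rewrite /cayley; field; rewrite sd td.
rewrite normcM normcV ler_pdivrMr ?normc_gt0 ?mulf_neq0//.
have -> : normc (0 +i* (2 * (s - t))) = 2 * `|s - t|.
  by rewrite /= expr0n add0r sqrtr_sqr normrM ger0_norm.
rewrite ler_peMr ?mulr_ge0// normcM.
have := normc_cayley_den s; have := normc_cayley_den t.
by move=> H1 H2; apply: (le_trans H2); rewrite ler_peMr ?normc_ge0.
Qed.

Definition circle_arc (z : R[i]) (z1 : normc z = 1) s : set_type (unit_circle R).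
Proof.
exists (z * cayley s); apply: mem_set.
by rewrite /unit_circle /= normr_normc normcM z1 normc_cayley mulr1.
Defined.

Lemma circle_arc_val z (z1 : normc z = 1) s :
  set_val (circle_arc z1 s) = z * cayley s.
Proof. by []. Qed.

Lemma circle_arc_continuous z (z1 : normc z = 1) : continuous (circle_arc z1).
Proof.
apply: continuous_comp_initial => s; apply/cvgcP => e e0.
near=> t; rewrite /= circle_arc_val circle_arc_val -mulrBr normcM z1 mul1r.
apply: (le_lt_trans (cayley_lipschitz s t)).
rewrite mulrC -ltr_pdivlMr//.
near: t; apply: (@nbhsx_ballx R R); by rewrite divr_gt0.
Unshelve. all: by end_near.
Qed.

Lemma circle_arc_injective z (z1 : normc z = 1) : injective (circle_arc z1).
Proof.
move=> s t /(congr1 set_val); rewrite !circle_arc_val => /cayley_eq.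
have z0 : z != 0 by rewrite -normc_gt0 z1.
rewrite -!mulrA => /(mulfI z0) /eqP; rewrite eq_complex /= => /andP[_ /eqP].
by rewrite !mul1r; lra.
Qed.

Lemma cayley_onto (z : R[i]) : normc z = 1 -> z != -1 -> exists s, z = cayley s.
Proof.
case: z => x y z1 zN1.
have xy : x ^+ 2 + y ^+ 2 = 1.
  move: z1 => /= /(congr1 (fun u => u ^+ 2)).
  by rewrite sqr_sqrtr ?expr1n// addr_ge0 ?sqr_ge0.
have x1 : 1 + x != 0.
  apply: contra zN1 => /eqP x1.
  have xE : x = - 1 by lra.
  have y0 : y ^+ 2 = 0 by rewrite xE in xy; lra.
  move/eqP: y0; rewrite sqrf_eq0 => /eqP y0.
  by rewrite xE y0 eq_complex /= oppr0 !eqxx.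
exists (y / (1 + x)); apply: (mulIf (cayley_den_neq0 (y / (1 + x)))).
rewrite /cayley divfK ?cayley_den_neq0//.
apply/eqP; rewrite eq_complex; apply/andP; split; apply/eqP => /=.
  have -> : x * 1 - y * - (y / (1 + x)) = (x * (1 + x) + y ^+ 2) / (1 + x).
    by field.
  rewrite (_ : x * (1 + x) + y ^+ 2 = x + (x ^+ 2 + y ^+ 2)); last by ring.
  by rewrite xy addrC divff.
by field.
Qed.

(** The transition between the parametrisations around [1] and around [-1]. *)
Lemma cayley_opp_inv s : s != 0 -> cayley s = - cayley (- s^-1).
Proof.
move=> s0; have sd := cayley_den_neq0 s; have td := cayley_den_neq0 (- s^-1).
apply: (mulIf sd); rewrite /cayley divfK//.
apply: (mulIf td); rewrite mulrAC mulNr divfK//.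
by apply/eqP; rewrite eq_complex; apply/andP; split; apply/eqP => /=; field.
Qed.

End Circle.

Theorem proposition4p3p2p4 (R : realType)
    (A : set (set_type (unit_circle R) -> complex R)) :
  uniform_algebra A -> regular_algebra A -> dense_invertible_group A ->
  A = C_of R (set_type (unit_circle R)).
Proof.
move=> ua rA dA; apply/seteqP; split; first exact: (ualg_continuous ua).
move=> F cF; apply: (approx_on_setT ua).
have p1 : normc (1 : R[i]) = 1 by exact: normc1.
have m1 : normc (-1 : R[i]) = 1 by rewrite normcNE.
pose c1 := circle_arc p1; pose c2 := circle_arc m1.
have cc1 : continuous c1 by exact: circle_arc_continuous.
have cc2 : continuous c2 by exact: circle_arc_continuous.
have ci1 : injective c1 by exact: circle_arc_injective.
have ci2 : injective c2 by exact: circle_arc_injective.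
have ab2 : -2 <= 2 :> R by lra.
have F1 : approx_on A (subarc c1 (-2) 2) F by exact: approx_on_arc.
have F2 : approx_on A (subarc c2 (-2) 2) F by exact: approx_on_arc.
(* [P] and [Q] are small arcs around [1] and [-1]; the points outside them have
   parameters of modulus between [1/2] and [2] in both parametrisations. *)
pose P := subarc c1 (- 2^-1) 2^-1; pose Q := subarc c2 (- 2^-1) 2^-1.
pose O := subarc c1 (-2) 2 `&` subarc c2 (-2) 2.
have cover : [set: set_type (unit_circle R)] `<=` P `|` O `|` Q.
  move=> x _.
  have x1 : normc (set_val x) = 1.
    have : `|set_val x| = 1 by exact: set_mem (valP x).
    by rewrite normr_normc => /(congr1 (@complex.Re R)).
  have [xN1|xN1] := eqVneq (set_val x) (-1).
    right; have -> : x = c2 0.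
      apply: val_inj; rewrite -[LHS]/(set_val x) -[RHS]/(-1 * cayley 0) xN1 /cayley.
      by rewrite oppr0 divff ?mulr1// oner_neq0.
    by apply: in_arc; lra.
  have [s xs] := cayley_onto x1 xN1.
  have xc1 : x = c1 s.
    by apply: val_inj; rewrite -[RHS]/(1 * cayley s) mul1r -xs.
  have [s1|s1] := leP `|s| 2^-1.
    by left; left; rewrite xc1; apply: in_arc; rewrite -ler_norml.
  have s0 : s != 0 by rewrite -normr_gt0; lra.
  have xc2 : x = c2 (- s^-1).
    by apply: val_inj; rewrite -[RHS]/(-1 * cayley (- s^-1)) mulN1r -cayley_opp_inv.
  have [s2|s2] := ltP 2 `|s|.
    right; rewrite xc2; apply: in_arc; rewrite -ler_norml normrN normfV.
    by rewrite lef_pV2 ?posrE//; lra.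
  left; right; split.
    by rewrite xc1; apply: in_arc; rewrite -ler_norml.
  rewrite xc2; apply: in_arc; rewrite -ler_norml normrN normfV.
  by rewrite -[leRHS]invrK lef_pV2 ?posrE ?invr_gt0//; lra.
apply: (approx_on_subset cover); apply: (approx_on_glue ua).
- apply: (regular_normal ua rA).
  + apply: (compact_closed (ualg_hausdorff ua)); exact: arc_compact.
  + apply: (compact_closed (ualg_hausdorff ua)); exact: arc_compact.
  + rewrite -subset0 => x [/arcP[t tI ->] /arcP[s sI]].
    move=> /(congr1 set_val); rewrite !circle_arc_val => /cayley_eq.
    move/eqP; rewrite eq_complex /= => /andP[/eqP + _].
    (* The two parameters of a point have product [-1]. *)
    move=> H; have : s * t = -1 by move: H; lra.
    nra.
- apply: approx_on_subset F1; rewrite subUset; split; last by move=> x [].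
  by apply: arc_subset; lra.
- apply: approx_on_subset F2; rewrite subUset; split; first by move=> x [].
  by apply: arc_subset; lra.
Qed.
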